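(* Let $\{(\xi_l,\overline{\xi}_l)\}_{l\in\mathbb Z}$ be an i.i.d. sequence of zero-mean random vectors in $\mathbb R^2$ such that $E[\xi_1^2]<\infty$, $E[\overline{\xi}_1^2]<\infty$ and $\sup_{t\ge 0}t^{\alpha}P(|\xi_1\overline{\xi}_1|>t)<\infty$ for some $\alpha>1$. Let $(c_l)_{l\in\mathbb Z}$, $(\overline c_l)_{l\in\mathbb Z}$ be real sequences satisfying $$\sup_{l\in\mathbb Z}|l|^{\sigma}|c_l|<\infty,\qquad \sup_{l\in\mathbb Z}|l|^{\overline{\sigma}}|\overline c_l|<\infty\quad\text{for some }\sigma,\overline{\sigma}\in\left(\tfrac12,1\right].$$ Define $d_k=\sum_{l,m=-\infty}^{\infty}c_{k-l}\overline c_{k-m}\xi_l\overline{\xi}_m$ and $d=E[\xi_1\overline{\xi}_1]\sum_{l=-\infty}^{\infty}c_l\overline c_l$. Then for every $p$ satisfying $p<\frac{1}{2-\sigma-\overline{\sigma}}\wedge\alpha\wedge 2$, $$\lim_{n\to\infty}\frac{1}{n^{1/p}}\sum_{k=1}^{n}(d_k-d)=0\quad\text{almost surely.}$$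
   Context: $a\wedge b=\min\{a,b\}$. All random variables are defined on a common probability space. *)

(* Defs.v *)
From HB Require Import structures.
From mathcomp Require Import all_boot all_order all_algebra.
From mathcomp Require Import all_classical all_reals all_analysis.
Set Implicit Arguments. Unset Strict Implicit. Unset Printing Implicit Defensive.
Import Order.TTheory GRing.Theory Num.Theory.
Import numFieldNormedType.Exports.
Local Open Scope classical_set_scope.
Local Open Scope ring_scope.

Section defs.
Context (d : measure_display) (T : measurableType d) (R : realType).

Definition rvpair (X Y : int -> T -> R) (l : int) : T -> R * R :=
  fun w => (X l w, Y l w).

Definition mutually_independent (P : probability T R) (V : int -> T -> R * R) :=
  forall (J : seq int) (E : int -> set (R * R)),
    uniq J -> (forall l, measurable (E l)) ->
    P (\bigcap_(l in [set` J]) (V l @^-1` E l)) =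
    (\prod_(l <- J) P (V l @^-1` E l))%E.

Definition identically_distributed (P : probability T R) (V : int -> T -> R * R) :=
  forall (l : int) (E : set (R * R)), measurable E ->
    P (V l @^-1` E) = P (V 0 @^-1` E).

End defs.

Definition zrange (N : nat) : seq int := [seq (i%:Z - N%:Z)%R | i <- iota 0 (2 * N).+1].

Definition dk {T : Type} {R : realType} (c cb : int -> R) (xi xib : int -> T -> R)
  (k : int) (w : T) : R :=
  limn (fun N : nat => \sum_(l <- zrange N) \sum_(m <- zrange N)
          c (k - l) * cb (k - m) * xi l w * xib m w).

Definition zseries {R : realType} (a : int -> R) : R :=
  limn (fun N : nat => \sum_(l <- zrange N) a l).

(* Main.v *)
(** Each factor of d_k converges almost surely (an orthogonal series with
polynomially decaying coefficients), so the centred sums S_n are almost sure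
limits, as N -> oo, of finite sums over indices in [-N, N]; moment bounds uniform
in N then pass to the limit by Fatou's lemma. On the dyadic block n <= 2^r we split
these sums into the two off-diagonal parts l < m and m < l, whose products
xi_l xib_m are pairwise orthogonal, and a diagonal part, a linear process with
absolutely summable coefficients c_l cb_l driven by xi_l xib_l, which we truncate
at level 2^(r/p). Increments over (x, y] of the off-diagonal and truncated parts
have second moments at most k_r (y - x), which a dyadic chaining inequality of
Rademacher-Menshov type turns into a bound on their maximum; the truncation error
is controlled in L^1. With q < alpha a moment of xi_l xib_l, p < q < 2, everything
divided by 2^(r/p) is summable in r. *)
Require Import Defs.
From HB Require Import structures.
From mathcomp Require Import all_boot all_order all_algebra.
From mathcomp Require Import all_classical all_reals all_analysis.
From mathcomp Require Import measurable_realfun.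
From mathcomp Require Import ring lra zify.
Import Order.TTheory GRing.Theory Num.Theory.
Import numFieldNormedType.Exports.
Local Open Scope classical_set_scope.
Local Open Scope ring_scope.

Set Implicit Arguments.
Unset Strict Implicit.

(** * Independence *)

(** Products over distinct indices have finite variance by independence alone; the diagonal products
    [xi_l xib_l] have only moments below [alpha], which is why they alone are truncated. The
    off-diagonal part must be halved because, for [l <> m], the products [xi_l xib_m] and
    [xi_m xib_l] have covariance [(E[xi_1 xib_1])^2], in general nonzero. The size of [k_r] decides
    the range of [p]. Correlations of the coefficients at lag [h] decay like [|h|^(1 - 2 sigma)] and
    [|h|^(1 - 2 sigmab)] up to an epsilon; summing their product over [|h| < 2^r] gives [k_r] of
    order [2^(kappa r)] for any [kappa >= 0] with [kappa > 3 - 2 sigma - 2 sigmab]. Summability asks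
    for [kappa + 1 < 2/p], and such a [kappa] exists exactly when [p < 2] and
    [p (2 - sigma - sigmab) < 1]. On the diagonal the truncation level is the normalisation itself,
    so variance and L^1 error both have relative size [2^(r (1 - q/p))], whence [q > p]. Fatou is
    applied to the chaining functional of a whole block: for almost every [w] and each [r] it is
    small for arbitrarily large windows [N], among which one close to the limit can be picked. *)

Section factor.
Context d (T : measurableType d) (R : realType) (P : probability T R).
Context d' (U : measurableType d').
Import HBNNSimple.

(** Standard extension from indicators to simple functions by linearity, then to nonnegative
    functions by monotone convergence on both sides. *)
Lemma ge0_integral_factor (V : T -> U) (G : T -> R) (K : R) (f : U -> R) :
  measurable_fun setT V -> measurable_fun setT G -> (forall w, 0 <= G w) ->
  0 <= K ->
  (forall E, measurable E ->
     (\int[P]_w (G w * \1_E (V w))%:E = K%:E * P (V @^-1` E))%E) ->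
  measurable_fun setT f -> (forall u, 0 <= f u) ->
  (\int[P]_w (G w * f (V w))%:E = K%:E * \int[P]_w (f (V w))%:E)%E.
Proof.
move=> mV mG G0 K0 GE mf f0.
have mf' : measurable_fun setT (EFin \o f) by exact/measurable_EFinP.
pose f_ := nnsfun_approx measurableT mf'.
have fcvg u : (EFin \o f_^~ u) n @[n --> \oo] --> (f u)%:E.
  by apply: cvg_nnsfun_approx => // x _; rewrite lee_fin.
have f_mono u m n : (m <= n)%N -> f_ m u <= f_ n u.
  by move=> mn; exact/lefP/nd_nnsfun_approx.
have mfV n : measurable_fun setT (fun w => f_ n (V w)).
  exact: measurableT_comp.
(* [H] is kept general because both sides need this: [H := G] on the left, [H := cst 1] on the
   right. *)
have mono_cv (H : T -> R) : measurable_fun setT H -> (forall w, 0 <= H w) ->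
    (\int[P]_w (H w * f (V w))%:E =
     limn (fun n => \int[P]_w (H w * f_ n (V w))%:E))%E.
  move=> mH H0.
  rewrite -monotone_convergence//.
  - apply: eq_integral => w _; apply/esym/cvg_lim => //.
    rewrite EFinM.
    under eq_fun do rewrite EFinM.
    by apply: cvgeZl => //; exact: fcvg.
  - by move=> n; apply/measurable_EFinP/measurable_funM.
  - by move=> n w _; rewrite lee_fin mulr_ge0.
  - by move=> w _ m n mn; rewrite lee_fin ler_wpM2l// f_mono.
have simple n (H : T -> R) : measurable_fun setT H -> (forall w, 0 <= H w) ->
    (\int[P]_w (H w * f_ n (V w))%:E = \sum_(k \in range (f_ n))
      k%:E * \int[P]_w (H w * \1_(f_ n @^-1` [set k]) (V w))%:E)%E.
  move=> mH H0.
  have mI k : measurable_fun setT (fun w => \1_(f_ n @^-1` [set k]) (V w) : R).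
    exact: measurableT_comp.
  transitivity (\int[P]_w (\sum_(k \in range (f_ n))
      (H w * (k * \1_(f_ n @^-1` [set k]) (V w)))%:E))%E.
    apply: eq_integral => w _.
    rewrite EFinM fimfunE -fsumEFin// ge0_mule_fsumr// => k.
    exact: nnfun_muleindic_ge0.
  rewrite ge0_integral_fsum//; last 2 first.
  - by move=> k; apply/measurable_EFinP; apply: measurable_funM => //; exact: measurable_funM.
  - move=> k w _; rewrite lee_fin mulr_ge0//.
    by have := nnfun_muleindic_ge0 (f_ n) k (V w); rewrite lee_fin.
  apply: eq_fsbigr => k /set_mem [u _ <-].
  rewrite -ge0_integralZl_EFin//.
  - by apply: eq_integral => w _; rewrite -EFinM mulrCA.
  - by move=> w _; rewrite lee_fin mulr_ge0.
  - by apply/measurable_EFinP/measurable_funM.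
rewrite mono_cv; [|exact: mG|exact: G0].
have one (h : U -> R) : (\int[P]_w (h (V w))%:E = \int[P]_w (cst 1%R w * h (V w))%:E)%E.
  by apply: eq_integral => w _; rewrite mul1r.
have -> : (\int[P]_w (f (V w))%:E = limn (fun n => \int[P]_w (f_ n (V w))%:E))%E.
  rewrite one mono_cv//; congr (limn _); apply/funext => n.
  by rewrite -one.
rewrite -limeMl//; last first.
  apply: ereal_nondecreasing_is_cvgn => m n mn; apply: ge0_le_integral => //.
  - by move=> w _; rewrite lee_fin.
  - by apply/measurable_EFinP; exact: mfV.
  - by apply/measurable_EFinP; exact: mfV.
  - by move=> w _; rewrite lee_fin f_mono.
congr (limn _); apply/funext => n.
rewrite simple// one simple// ge0_mule_fsumr//; last first.
  move=> k.
  (* Nonnegativity of the summand is required for every real [k]: a value that is not attained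
     contributes 0, an attained one is nonnegative. *)
  have [->|k0] := eqVneq (f_ n @^-1` [set k]) set0.
    rewrite integral0_eq ?mule0// => w _.
    by rewrite indicE in_set0 mulr0.
  have : 0 <= k by case/set0P : k0 => u /= <-.
  by move=> ?; rewrite mule_ge0// integral_ge0// => w _; rewrite lee_fin mul1r.
apply: eq_fsbigr => k _.
have mfk : measurable (f_ n @^-1` [set k]) by [].
rewrite GE// muleCA; congr (_ * (_ * _))%E.
rewrite -(setIT (V @^-1` _)) -integral_indic//; last first.
  by rewrite -[X in measurable X]setTI; exact: mV.
by apply: eq_integral => w _; rewrite mul1r !indicE.
Qed.

End factor.

(** * Real-valued integrability and expectation *)

Section L1.
Context d (T : measurableType d) (R : realType) (P : probability T R).
Implicit Types (f g : T -> R).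

Definition L1 f := P.-integrable setT (EFin \o f).
(** A real number, with the default value 0 when the extended integral is infinite; hence the [L1]
    hypotheses in the linearity rules. *)
Definition Ex f : R := \int[P]_w f w.

Lemma L1_measurable f : L1 f -> measurable_fun setT f.
Proof. by move=> /measurable_int/measurable_EFinP. Qed.

Lemma L1_Ex f : L1 f -> (\int[P]_w (f w)%:E)%E = (Ex f)%:E.
Proof. by move=> If; rewrite /Ex /Rintegral fineK//; exact: integrable_fin_num. Qed.

Lemma L1_ge0 f : measurable_fun setT f -> (forall w, 0 <= f w) ->
  (\int[P]_w (f w)%:E < +oo)%E -> L1 f.
Proof.
move=> mf f0 foo; apply/integrableP; split; first exact/measurable_EFinP.
by under eq_integral do rewrite /= ger0_norm//.
Qed.

Lemma L1_le f g : measurable_fun setT f -> (forall w, `|f w| <= g w) -> L1 g -> L1 f.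
Proof.
move=> mf fg; apply: le_integrable => //; first exact/measurable_EFinP.
by move=> w _ /=; rewrite lee_fin (le_trans (fg w))// ler_norm.
Qed.

Lemma L1_cst (k : R) : L1 (fun=> k).
Proof. exact: finite_measure_integrable_cst. Qed.

Lemma L1D f g : L1 f -> L1 g -> L1 (fun w => f w + g w).
Proof. by move=> If Ig; exact: (integrableD measurableT If Ig). Qed.

Lemma L1B f g : L1 f -> L1 g -> L1 (fun w => f w - g w).
Proof. by move=> If Ig; exact: (integrableB measurableT If Ig). Qed.

Lemma L1Z (k : R) f : L1 f -> L1 (fun w => k * f w).
Proof. by move=> If; exact: (integrableZl measurableT k If). Qed.

Lemma L1_norm f : L1 f -> L1 (fun w => `|f w|).
Proof. by move=> If; exact: (integrable_norm If). Qed.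

Lemma L1_sum I (s : seq I) (F : I -> T -> R) : (forall i, L1 (F i)) ->
  L1 (fun w => \sum_(i <- s) F i w).
Proof.
move=> IF; elim: s => [|i s ih].
  by under eq_fun do rewrite big_nil; exact: L1_cst.
by under eq_fun do rewrite big_cons; exact: L1D.
Qed.

Lemma ExD f g : L1 f -> L1 g -> Ex (fun w => f w + g w) = Ex f + Ex g.
Proof. by move=> If Ig; rewrite /Ex RintegralD. Qed.

Lemma ExB f g : L1 f -> L1 g -> Ex (fun w => f w - g w) = Ex f - Ex g.
Proof. by move=> If Ig; rewrite /Ex RintegralB. Qed.

Lemma ExZ (k : R) f : L1 f -> Ex (fun w => k * f w) = k * Ex f.
Proof. by move=> If; rewrite /Ex RintegralZl. Qed.

Lemma Ex_cst (k : R) : Ex (fun=> k) = k.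
Proof. by rewrite /Ex Rintegral_cst//= probability_setT mulr1. Qed.

Lemma Ex_ge0 f : (forall w, 0 <= f w) -> 0 <= Ex f.
Proof. by move=> f0; exact: Rintegral_ge0. Qed.

Lemma Ex_le f g : L1 f -> L1 g -> (forall w, f w <= g w) -> Ex f <= Ex g.
Proof. by move=> If Ig fg; exact: le_Rintegral. Qed.

Lemma Ex_sum I (s : seq I) (F : I -> T -> R) : (forall i, L1 (F i)) ->
  Ex (fun w => \sum_(i <- s) F i w) = \sum_(i <- s) Ex (F i).
Proof.
move=> IF; elim: s => [|i s ih].
  under [in LHS]eq_fun do rewrite big_nil.
  by rewrite Ex_cst big_nil.
under [in LHS]eq_fun do rewrite big_cons.
by rewrite big_cons ExD ?ih//; exact: L1_sum.
Qed.

Lemma measurable_fun_indic_comp d' (U : measurableType d') (V : T -> U) (E : set U) :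
  measurable_fun setT V -> measurable E ->
  measurable_fun setT (fun w => \1_E (V w) : R).
Proof. by move=> mV mE; exact: measurableT_comp. Qed.

Lemma Ex_indic_comp d' (U : measurableType d') (V : T -> U) (E : set U) :
  measurable_fun setT V -> measurable E ->
  Ex (fun w => \1_E (V w)) = fine (P (V @^-1` E)).
Proof.
move=> mV mE; rewrite /Ex /Rintegral; congr fine.
rewrite -(setIT (V @^-1` E)) -integral_indic//.
by rewrite -[X in measurable X]setTI; exact: mV.
Qed.

Lemma L1_mul_indic d' (U : measurableType d') (V : T -> U) (E : set U) f :
  measurable_fun setT V -> measurable E -> L1 f -> L1 (fun w => f w * \1_E (V w)).
Proof.
move=> mV mE If; apply: (L1_le (g := fun w => `|f w|)); last exact: L1_norm.
  by apply: measurable_funM; [exact: (L1_measurable If)|exact: measurable_fun_indic_comp].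
move=> w; rewrite normrM ler_piMr// indicE.
by case: (_ \in _); rewrite ?normr1 ?normr0.
Qed.

End L1.

Section factor_signed.
Context d (T : measurableType d) (R : realType) (P : probability T R).
Context d' (U : measurableType d') (V : T -> U).
Hypothesis mV : measurable_fun setT V.
Local Notation L1 := (L1 P).
Local Notation Ex := (Ex P).

(** The only trace of the independence of [G] and [V] that is needed; taking [E = setT] forces
    [K = Ex G]. *)
Definition factors (G : T -> R) (K : R) := forall E, measurable E ->
  Ex (fun w => G w * \1_E (V w)) = K * fine (P (V @^-1` E)).

Lemma factors_ge0 G K : (forall w, 0 <= G w) -> factors G K -> 0 <= K.
Proof.
move=> G0 /(_ setT measurableT).
rewrite preimage_setT probability_setT mulr1 => <-.
by apply: Ex_ge0 => w; rewrite mulr_ge0.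
Qed.

Lemma factors_ge0E G K : L1 G -> (forall w, 0 <= G w) -> factors G K ->
  forall f : U -> R, measurable_fun setT f -> (forall u, 0 <= f u) ->
  (\int[P]_w (G w * f (V w))%:E = K%:E * \int[P]_w (f (V w))%:E)%E.
Proof.
move=> IG G0 GK f mf f0; apply: ge0_integral_factor => //.
- exact: (L1_measurable IG).
- exact: factors_ge0 GK.
- move=> E mE; rewrite L1_Ex; last exact: L1_mul_indic.
  rewrite GK// EFinM fineK// fin_num_measure//.
  by rewrite -[X in measurable X]setTI; exact: mV.
Qed.

Lemma factors_ge0_ge0 (G : T -> R) K (f : U -> R) : L1 G -> (forall w, 0 <= G w) -> factors G K ->
  measurable_fun setT f -> (forall u, 0 <= f u) -> L1 (f \o V) ->
  L1 (fun w => G w * f (V w)) /\ Ex (fun w => G w * f (V w)) = K * Ex (f \o V).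
Proof.
move=> IG G0 GK mf f0 If.
have H := factors_ge0E IG G0 GK mf f0.
have I : L1 (fun w => G w * f (V w)).
  apply: L1_ge0 => [|w|].
  - by apply: measurable_funM; [exact: (L1_measurable IG)|exact: measurableT_comp].
  - exact: mulr_ge0.
  - by rewrite H (L1_Ex If) -EFinM ltry.
split=> //; apply: EFin_inj.
by rewrite -(L1_Ex I) H (L1_Ex If) EFinM.
Qed.

Lemma factors_ge0_signed (G : T -> R) K (f : U -> R) : L1 G -> (forall w, 0 <= G w) -> factors G K ->
  measurable_fun setT f -> L1 (f \o V) ->
  L1 (fun w => G w * f (V w)) /\ Ex (fun w => G w * f (V w)) = K * Ex (f \o V).
Proof.
move=> IG G0 GK mf If.
(* Positive and negative parts, written as combinations of [f] and its absolute value so that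
   measurability and integrability follow from linearity. *)
pose fp u := 2^-1 * (`|f u| + f u); pose fn u := 2^-1 * (`|f u| - f u).
have fE : f = fun u => fp u - fn u by apply/funext => u; rewrite /fp /fn; field.
have mnf : measurable_fun setT (fun u => `|f u|) by exact: measurableT_comp.
have mfp : measurable_fun setT fp.
  by apply: measurable_funM => //; exact: measurable_funD.
have mfn : measurable_fun setT fn.
  by apply: measurable_funM => //; exact: measurable_funB.
have fp0 u : 0 <= fp u by rewrite mulr_ge0// -lerBlDr sub0r -normrN ler_norm.
have fn0 u : 0 <= fn u by rewrite mulr_ge0// subr_ge0 ler_norm.
have Ifp : L1 (fp \o V) by apply: L1Z; apply: L1D => //; exact: L1_norm.
have Ifn : L1 (fn \o V) by apply: L1Z; apply: L1B => //; exact: L1_norm.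
have [I1 E1] := factors_ge0_ge0 IG G0 GK mfp fp0 Ifp.
have [I2 E2] := factors_ge0_ge0 IG G0 GK mfn fn0 Ifn.
have -> : (fun w => G w * f (V w)) = fun w => G w * fp (V w) - G w * fn (V w).
  by apply/funext => w; rewrite {1}fE mulrBr.
split; first exact: L1B.
rewrite ExB// E1 E2 -mulrBr; congr (_ * _).
rewrite -ExB//; congr Ex; apply/funext => w.
by rewrite /= /fp /fn; field.
Qed.

(** The hypothesis on the absolute value of [G] is what makes the positive and negative parts of [G]
    factor separately, with constants [(K' + K)/2] and [(K' - K)/2]. *)
Lemma factors_signed (G : T -> R) K K' (f : U -> R) : L1 G -> factors G K -> factors (fun w => `|G w|) K' ->
  measurable_fun setT f -> L1 (f \o V) ->
  L1 (fun w => G w * f (V w)) /\ Ex (fun w => G w * f (V w)) = K * Ex (f \o V).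
Proof.
move=> IG GK GK' mf If.
have InG := L1_norm IG.
pose Gp w := 2^-1 * (`|G w| + G w); pose Gn w := 2^-1 * (`|G w| - G w).
have Gp0 w : 0 <= Gp w by rewrite mulr_ge0// -lerBlDr sub0r -normrN ler_norm.
have Gn0 w : 0 <= Gn w by rewrite mulr_ge0// subr_ge0 ler_norm.
have IGp : L1 Gp by apply: L1Z; exact: L1D.
have IGn : L1 Gn by apply: L1Z; exact: L1B.
have GpK : factors Gp (2^-1 * (K' + K)).
  move=> E mE.
  rewrite -[LHS](_ : Ex (fun w => 2^-1 * (`|G w| * \1_E (V w) + G w * \1_E (V w))) = _).
    have I1 := L1_mul_indic mV mE InG; have I2 := L1_mul_indic mV mE IG.
    by rewrite ExZ ?ExD// ?GK ?GK'// ?mulrDl ?mulrA//; [ring|exact: L1D].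
  by congr Ex; apply/funext => w; rewrite /Gp; ring.
have GnK : factors Gn (2^-1 * (K' - K)).
  move=> E mE.
  rewrite -[LHS](_ : Ex (fun w => 2^-1 * (`|G w| * \1_E (V w) - G w * \1_E (V w))) = _).
    have I1 := L1_mul_indic mV mE InG; have I2 := L1_mul_indic mV mE IG.
    by rewrite ExZ ?ExB// ?GK ?GK'//; [ring|exact: L1B].
  by congr Ex; apply/funext => w; rewrite /Gn; ring.
have [I1 E1] := factors_ge0_signed IGp Gp0 GpK mf If.
have [I2 E2] := factors_ge0_signed IGn Gn0 GnK mf If.
have -> : (fun w => G w * f (V w)) = fun w => Gp w * f (V w) - Gn w * f (V w).
  by apply/funext => w; rewrite /Gp /Gn; field.
split; first exact: L1B.
by rewrite ExB// E1 E2; field.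
Qed.

End factor_signed.

(** * Product formula for functions of independent vectors *)

Section independence.
Context d (T : measurableType d) (R : realType) (P : probability T R).
Variable V : int -> T -> R * R.
Hypothesis mV : forall l, measurable_fun setT (V l).
Hypothesis indV : mutually_independent P V.
Local Notation L1 := (L1 P).
Local Notation Ex := (Ex P).

Lemma indep_indic (J : seq int) (E : int -> set (R * R)) :
  uniq J -> (forall l, measurable (E l)) ->
  Ex (fun w => \prod_(l <- J) \1_(E l) (V l w)) =
  \prod_(l <- J) Ex (fun w => \1_(E l) (V l w)).
Proof.
move=> uJ mE.
have -> : (fun w => \prod_(l <- J) \1_(E l) (V l w)) =
    (\1_(\bigcap_(l in [set` J]) (V l @^-1` E l)) : T -> R).
  apply/funext => w; rewrite indicE.
  have [/set_mem wE|/negP wE] := boolP (w \in _).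
    rewrite big_seq big1// => l lJ.
    by rewrite indicE mem_set//; exact: wE.
  have : ~ (forall l, l \in J -> E l (V l w)).
    by move=> h; apply: wE; apply/mem_set => l lJ; exact: h.
  move=> /existsNP[l /not_implyP[lJ lE]].
  rewrite (big_rem l)//= indicE memNset// mul0r//.
have mVE l : measurable (V l @^-1` E l).
  by rewrite -[X in measurable X]setTI; exact: mV.
under [RHS]eq_bigr do rewrite Ex_indic_comp//.
rewrite /Ex /Rintegral integral_indic//; last first.
  by apply: fin_bigcap_measurable => // l _; exact: mVE.
rewrite setIT (_ : fine _ = fine (\prod_(l <- J) P (V l @^-1` E l))%E); last first.
  by congr fine; exact: indV.
apply: EFin_inj; rewrite fineK; last first.
  by apply: prode_fin_num => l _; exact: fin_num_measure.
elim: {uJ} J => [|l J ih]; first by rewrite !big_nil.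
by rewrite !big_cons EFinM -ih fineK// fin_num_measure.
Qed.

Lemma prod_indic_le1 (J : seq int) (E : int -> set (R * R)) w :
  0 <= \prod_(l <- J) (\1_(E l) (V l w) : R) <= 1.
Proof.
elim: J => [|l J /andP[ih0 ih1]]; first by rewrite big_nil ler01 lexx.
rewrite big_cons indicE; case: (_ \in _); first by rewrite !mul1r ih0.
by rewrite mul0r lexx ler01.
Qed.

(** Indicators are replaced by integrable functions one index at a time. Keeping a list [J'] of
    indicators makes the induction close: the induction hypothesis with [j] moved into [J'] says
    that the product of the other factors satisfies [factors] with respect to [V j]. *)
Lemma indep_mixed (J J' : seq int) (f : int -> R * R -> R) (E : int -> set (R * R)) :
  uniq (J ++ J') -> (forall l, measurable (E l)) ->
  (forall l, measurable_fun setT (f l)) -> (forall l, l \in J -> L1 (f l \o V l)) ->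
  L1 (fun w => \prod_(l <- J) f l (V l w) * \prod_(l <- J') \1_(E l) (V l w)) /\
  Ex (fun w => \prod_(l <- J) f l (V l w) * \prod_(l <- J') \1_(E l) (V l w)) =
  \prod_(l <- J) Ex (f l \o V l) * \prod_(l <- J') Ex (fun w => \1_(E l) (V l w)).
Proof.
elim: J => [|j J ih] in J' f E *.
  rewrite /= => uJ' mE mf _; split; last first.
    rewrite big_nil mul1r -indep_indic//; congr Ex.
    by apply/funext => w; rewrite big_nil mul1r.
  apply: (L1_le (g := fun=> 1)); last exact: L1_cst.
    apply: measurable_funM; first by under eq_fun do rewrite big_nil; exact: measurable_cst.
    by apply: measurable_prod => l _; exact: (measurable_fun_indic_comp (mV l) (mE l)).
  move=> w; rewrite big_nil mul1r.
  by have /andP[h0 h1] := prod_indic_le1 J' E w; rewrite ger0_norm.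
move=> uJ mE mf If.
have uJ' : uniq (J ++ j :: J').
  by have /permPl pe := perm_catCA [:: j] J J'; rewrite -(perm_uniq pe).
have jJ' : j \notin J'.
  by move: uJ; rewrite /= mem_cat negb_or => /andP[/andP[]].
have uJJ' : uniq (J ++ J') by move: uJ => /= /andP[].
pose G (h : int -> R * R -> R) w :=
  \prod_(l <- J) h l (V l w) * \prod_(l <- J') (\1_(E l) (V l w) : R).
(* Stated for any [h] since [factors_signed] wants it for [f] and for its absolute value. *)
have GK (h : int -> R * R -> R) : (forall l, measurable_fun setT (h l)) ->
    (forall l, l \in J -> L1 (h l \o V l)) ->
    L1 (G h) /\ factors P (V j) (G h) (\prod_(l <- J) Ex (h l \o V l) *
       \prod_(l <- J') Ex (fun w => \1_(E l) (V l w))).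
  move=> mh Ih; split; first by have [] := ih J' h E uJJ' mE mh Ih.
  move=> E0 mE0.
  (* Overriding the set at [j] does not disturb the indicators over [J'], because [j] is not in
     [J']. *)
  pose E' l := if l == j then E0 else E l.
  have mE' l : measurable (E' l) by rewrite /E'; case: ifP.
  have E'j : E' j = E0 by rewrite /E' eqxx.
  have E'E l : l \in J' -> E' l = E l.
    by move=> lJ'; rewrite /E'; case: eqP => // lj; rewrite -lj lJ' in jJ'.
  have [_ /esym] := ih (j :: J') h E' uJ' mE' mh Ih.
  rewrite big_cons.
  have -> : \prod_(l <- J') Ex (fun w => \1_(E' l) (V l w)) =
      \prod_(l <- J') Ex (fun w => \1_(E l) (V l w)).
    by apply: eq_big_seq => l lJ'; rewrite E'E.
  rewrite E'j Ex_indic_comp// => H.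
  rewrite -mulrA [_ * fine _]mulrC H; congr Ex; apply/funext => w.
  rewrite big_cons /G E'j.
  have -> : \prod_(l <- J') \1_(E' l) (V l w) = \prod_(l <- J') \1_(E l) (V l w) :> R.
    by apply: eq_big_seq => l lJ'; rewrite E'E.
  by rewrite -mulrA [_ * \1_ _ _]mulrC.
have IfJ l : l \in J -> L1 (f l \o V l) by move=> lJ; apply: If; rewrite inE lJ orbT.
have [IG KG] := GK f mf IfJ.
have mnf l : measurable_fun setT (fun u => `|f l u|) by exact: measurableT_comp.
have InfJ l : l \in J -> L1 ((fun u => `|f l u|) \o V l).
  by move=> lJ; exact: L1_norm (IfJ l lJ).
have [_ KnG] := GK (fun l u => `|f l u|) mnf InfJ.
have GnE : G (fun l u => `|f l u|) = fun w => `|G f w|.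
  apply/funext => w; rewrite /G normrM normr_prod; congr (_ * _).
  by rewrite ger0_norm//; have /andP[] := prod_indic_le1 J' E w.
rewrite GnE in KnG.
have [] := factors_signed (mV j) IG KG KnG (mf j) (If j (mem_head _ _)).
have -> : (fun w => G f w * f j (V j w)) = (fun w => \prod_(l <- j :: J) f l (V l w) *
   \prod_(l <- J') \1_(E l) (V l w)).
  by apply/funext => w; rewrite big_cons /G; ring.
by move=> -> ->; split=> //; rewrite big_cons; ring.
Qed.

Lemma indep_prod (J : seq int) (f : int -> R * R -> R) : uniq J ->
  (forall l, measurable_fun setT (f l)) -> (forall l, l \in J -> L1 (f l \o V l)) ->
  L1 (fun w => \prod_(l <- J) f l (V l w)) /\
  Ex (fun w => \prod_(l <- J) f l (V l w)) = \prod_(l <- J) Ex (f l \o V l).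
Proof.
move=> uJ mf If.
have := @indep_mixed J [::] f (fun=> setT); rewrite cats0 => /(_ uJ (fun=> measurableT) mf If).
rewrite big_nil mulr1.
have -> // : (fun w => \prod_(l <- J) f l (V l w) * \prod_(l <- [::]) \1_setT (V l w)) =
  (fun w => \prod_(l <- J) f l (V l w)).
by apply/funext => w; rewrite big_nil mulr1.
Qed.

End independence.

(** * Dyadic chaining *)

Section dyadic.
Context {R : realType}.
Implicit Types (s : nat -> R).

(** Squared increments over the left halves of all dyadic subintervals of [[a, a + 2^r]], together
    with the unit intervals. Any point of the interval is reached from [a] by at most one such
    increment per level. *)
Fixpoint dyadicQ (r a : nat) s : R :=
  match r with
  | 0 => (s a.+1 - s a) ^+ 2
  | r'.+1 => (s (a + 2 ^ r')%N - s a) ^+ 2 + (dyadicQ r' a s + dyadicQ r' (a + 2 ^ r') s)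
  end.

Lemma dyadicQ_ge0 r a s : 0 <= dyadicQ r a s.
Proof.
elim: r a => [|r ih] a /=; first exact: sqr_ge0.
by rewrite addr_ge0 ?sqr_ge0// addr_ge0.
Qed.

(* With v = s (a + 2^r) - s a, uses (u + v)^2 <= (1 + 1/(r+1)) u^2 + (r+2) v^2. *)
Lemma dyadicQ_max r a s m : (m <= 2 ^ r)%N ->
  (s (a + m)%N - s a) ^+ 2 <= r.+1%:R * dyadicQ r a s.
Proof.
elim: r a m => [|r ih] a m /=.
  rewrite expn0 mul1r; case: m => [_|[_|//]].
    by rewrite addn0 subrr expr0n/= sqr_ge0.
  by rewrite addn1.
move=> hm.
have := dyadicQ_ge0 r a s; have := dyadicQ_ge0 r (a + 2 ^ r) s.
set Q1 := dyadicQ r a s; set Q2 := dyadicQ r _ s => Q20 Q10.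
have r0 : 0 <= r%:R :> R by [].
have [mr|rm] := leqP m (2 ^ r).
  have := ih a m mr; rewrite -/Q1 => h; apply: (le_trans h).
  rewrite -!natr1; have := sqr_ge0 (s (a + 2 ^ r)%N - s a); nra.
have := ih (a + 2 ^ r)%N (m - 2 ^ r)%N; rewrite leq_subLR addnn -mul2n -expnS => /(_ hm).
rewrite -addnA subnKC; last exact: ltnW.
rewrite -/Q2.
set x := s (a + m)%N; set y := s (a + 2 ^ r)%N; set z := s a => h.
have -> : x - z = (x - y) + (y - z) by ring.
set u := x - y in h *; set v := y - z.
have n0 : 0 < r.+1%:R :> R by [].
have h1 : (u + v) ^+ 2 <= r.+1%:R^-1 * u ^+ 2 * r.+2%:R + r.+2%:R * v ^+ 2.
  rewrite -subr_ge0.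
  rewrite [X in 0 <= X](_ : _ = r.+1%:R^-1 * (u - r.+1%:R * v) ^+ 2); last first.
    by rewrite -[r.+2%:R]natr1; field; apply/eqP => e; have := n0; lra.
  by rewrite mulr_ge0 ?invr_ge0 ?sqr_ge0// ltW.
apply: (le_trans h1).
have h2 : r.+1%:R^-1 * u ^+ 2 <= Q2 by rewrite ler_pdivrMl.
have aux (k A B C D : R) : 0 <= k -> A <= C -> 0 <= B -> A * k + k * D <= k * (D + (B + C)).
  move=> k0 AC B0; have : 0 <= k * (C - A) by rewrite mulr_ge0// subr_ge0.
  have : 0 <= k * B by rewrite mulr_ge0.
  rewrite mulrBr !mulrDr; lra.
exact: aux.
Qed.

(** From [(|u| - e)^2 >= 0]. It converts control of squares into control of absolute values without
    square roots, at the price of a free threshold [e]. *)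
Lemma sqrt_bound (e u : R) : 0 < e -> `|u| <= e + u ^+ 2 / e.
Proof.
move=> e0; have h : 0 <= (`|u| - e) ^+ 2 by exact: sqr_ge0.
rewrite -(ler_pM2r e0) mulrDl -[X in _ <= _ + X]mulrA mulVf ?gt_eqF// mulr1.
by rewrite -real_normK ?num_real//; have := sqr_ge0 `|u|; have := sqr_ge0 e; nra.
Qed.

(** With [t] the square root of [rho], it suffices that [(r+1) t^r <= 1/(1-t)], which holds because
    [(r+1) t^r] is at most the sum of [t^i] for [i <= r]; the induction uses [K = t K + 1]. *)
Lemma succ_sqr_geometric (rho : R) : 0 < rho < 1 ->
  exists2 C, 0 <= C & forall r : nat, r.+1%:R ^+ 2 * rho ^+ r <= C.
Proof.
move=> /andP[r0 r1].
pose t := Num.sqrt rho.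
have t0 : 0 < t by rewrite sqrtr_gt0.
have tt : t ^+ 2 = rho by rewrite sqr_sqrtr// ltW.
have t1 : t < 1 by rewrite -sqrtr1 ltr_sqrt.
pose K := (1 - t)^-1.
have K0 : 0 < K by rewrite invr_gt0 subr_gt0.
exists (K ^+ 2); first exact: sqr_ge0.
suff h r : r.+1%:R * t ^+ r <= K.
  move=> r; rewrite -tt exprAC -exprMn; apply: lerXn2r (h r); rewrite nnegrE.
    by rewrite mulr_ge0// exprn_ge0// ltW.
  exact: ltW.
elim: r => [|r ih].
  by rewrite expr0 mulr1 invf_ge1 ?subr_gt0// gerBl ltW.
rewrite -natr1 mulrDl exprS mul1r.
have tr : t ^+ r <= 1 by rewrite exprn_ile1 ?ltW.
have -> : K = t * K + 1.
  by rewrite /K; field; rewrite subr_eq0 eq_sym lt_eqF.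
have := ih; have : 0 <= t ^+ r by rewrite exprn_ge0// ltW.
set q := t ^+ r in tr *; set N := r.+1%:R => q0 ih'.
have : 0 <= t * (K - N * q) by rewrite mulr_ge0 ?subr_ge0// ltW.
have : t * q <= 1 by rewrite mulr_ile1 // ltW.
rewrite mulrBr mulrCA; lra.
Qed.

(** Write [rho^r = t^r t^r]: one factor absorbs [(r+1)^2], the other is left as a geometric
    majorant. *)
Lemma cvg_series_succ_sqr_geometric (rho K : R) : 0 < rho < 1 ->
  cvgn (series (fun r : nat => K * (r.+1%:R ^+ 2 * rho ^+ r))).
Proof.
move=> /andP[r0 r1].
pose t := Num.sqrt rho.
have t0 : 0 < t by rewrite sqrtr_gt0.
have tt : t ^+ 2 = rho by rewrite sqr_sqrtr// ltW.
have t1 : t < 1 by rewrite -sqrtr1 ltr_sqrt.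
have [|C C0 hC] := @succ_sqr_geometric t; first by rewrite t0 t1.
apply: normed_cvg.
apply: (@series_le_cvg _ _ (fun r => geometric (`|K| * C) t r)) => [r|r|r|].
- exact: normr_ge0.
- by rewrite /= mulr_ge0 ?mulr_ge0// exprn_ge0// ltW.
- rewrite /geometric /= normrM -[leRHS]mulrA ler_wpM2l// ger0_norm; last first.
    by rewrite mulr_ge0 ?sqr_ge0// exprn_ge0// ltW.
  have -> : rho ^+ r = t ^+ r * t ^+ r by rewrite -tt exprAC expr2.
  by rewrite mulrA ler_wpM2r// exprn_ge0// ltW.
- by apply: is_cvg_geometric_series; rewrite ger0_norm// ltW.
Qed.

End dyadic.

(** * Orthogonal sums, mean of the chaining functional, Fatou in the window size *)

Section second_moments.
Context d (T : measurableType d) (R : realType) (P : probability T R).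
Local Notation L1 := (L1 P).
Local Notation Ex := (Ex P).

Lemma L1_mul (X Y : T -> R) : measurable_fun setT X -> measurable_fun setT Y ->
  L1 (fun w => X w ^+ 2) -> L1 (fun w => Y w ^+ 2) -> L1 (fun w => X w * Y w).
Proof.
move=> mX mY IX IY; apply: L1_le (L1D IX IY); first exact: measurable_funM.
move=> w; rewrite normrM -[X w ^+ 2]real_normK ?num_real// -[Y w ^+ 2]real_normK ?num_real//.
have := sqr_ge0 (`|X w| - `|Y w|).
have : 0 <= `|X w| * `|Y w| by rewrite mulr_ge0.
rewrite sqrrB; lra.
Qed.

(** Only the diagonal of the expanded square survives. Pairwise orthogonality is enough, so this
    covers products indexed by pairs, which are not independent. *)
Lemma Ex_orthogonal_sum (I : eqType) (s : seq I) (Z : I -> T -> R) (x : I -> R) (K : R) :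
  uniq s -> (forall i, measurable_fun setT (Z i)) ->
  (forall i, L1 (fun w => Z i w ^+ 2)) ->
  (forall i j, i != j -> Ex (fun w => Z i w * Z j w) = 0) ->
  (forall i, Ex (fun w => Z i w ^+ 2) <= K) ->
  L1 (fun w => (\sum_(i <- s) x i * Z i w) ^+ 2) /\
  Ex (fun w => (\sum_(i <- s) x i * Z i w) ^+ 2) <= K * \sum_(i <- s) x i ^+ 2.
Proof.
move=> us mZ IZ oZ ZK.
have IZZ i j : L1 (fun w => Z i w * Z j w) by exact: L1_mul.
have -> : (fun w => (\sum_(i <- s) x i * Z i w) ^+ 2) =
    fun w => \sum_(i <- s) \sum_(j <- s) (x i * x j) * (Z i w * Z j w).
  apply/funext => w; rewrite expr2 mulr_suml; apply: eq_bigr => i _.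
  by rewrite mulr_sumr; apply: eq_bigr => j _; ring.
have I2 i : L1 (fun w => \sum_(j <- s) (x i * x j) * (Z i w * Z j w)).
  by apply: L1_sum => j; exact: L1Z.
split; first exact: L1_sum.
rewrite Ex_sum// mulr_sumr big_seq [leRHS]big_seq; apply: ler_sum => i si.
rewrite Ex_sum => [|j]; last exact: L1Z.
rewrite (bigD1_seq i)//= big1 ?addr0 => [|j ji]; last first.
  by rewrite ExZ// oZ ?mulr0// eq_sym.
rewrite ExZ//; rewrite -expr2 [K * _]mulrC ler_wpM2l ?sqr_ge0//; exact: ZK.
Qed.

(** There are [r+1] levels, and the intervals of one level are disjoint with total length at most
    [2^r]. *)
Lemma Ex_dyadicQ (S : nat -> T -> R) (K : R) r a :
  0 <= K ->
  (forall x y, (a <= x)%N -> (x <= y)%N -> (y <= a + 2 ^ r)%N ->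
    L1 (fun w => (S y w - S x w) ^+ 2) /\
    Ex (fun w => (S y w - S x w) ^+ 2) <= K * (y - x)%:R) ->
  L1 (fun w => dyadicQ r a (S^~ w)) /\
  Ex (fun w => dyadicQ r a (S^~ w)) <= K * (r.+1%:R * (2 ^ r)%:R).
Proof.
move=> K0; elim: r a => [|r ih] a H.
  have [I E] := H a a.+1 (leqnn _) (leqnSn _) (ltac:(by rewrite expn0 addn1)).
  by split => //; apply: (le_trans E); rewrite subSnn expn0 mul1r.
have e2 : (2 ^ r.+1 = 2 ^ r + 2 ^ r)%N by rewrite expnS mul2n addnn.
have [I0 E0] := H a (a + 2 ^ r)%N (leqnn _) (leq_addr _ _) (ltac:(rewrite e2; lia)).
have [|I1 E1] := ih a.
  by move=> x y ax xy ya; apply: H => //; rewrite e2; lia.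
have [|I2 E2] := ih (a + 2 ^ r)%N.
  by move=> x y ax xy ya; apply: H => //; rewrite ?e2; lia.
split; first by apply: L1D => //; exact: L1D.
rewrite ExD ?ExD//; last exact: L1D.
apply: (le_trans (lerD E0 (lerD E1 E2))).
rewrite addKn e2 natrD -[r.+2%:R]natr1.
by rewrite -subr_ge0 [X in 0 <= X](_ : _ = K * (2 ^ r)%:R) ?mulr_ge0//; ring.
Qed.

Lemma limn_einf_ub (u : (\bar R)^nat) (l : \bar R) : (forall n, u n <= l)%E -> (limn_einf u <= l)%E.
Proof.
move=> ul; rewrite limn_einf_lim; apply: lime_le; first exact: is_cvg_einfs.
by apply: nearW => n; apply: (le_trans _ (ul n)); apply: ereal_inf_lbound; exists n => /=.
Qed.

Lemma limn_einf_frequently (u : (\bar R)^nat) (l : \bar R) : (limn_einf u < l)%E ->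
  forall N0, exists2 N, (N0 <= N)%N & (u N < l)%E.
Proof.
move=> ul N0.
have h : (einfs u N0 < l)%E.
  apply: le_lt_trans ul; rewrite limn_einf_lim; apply: lime_ge; first exact: is_cvg_einfs.
  by exists N0 => // n /= N0n; exact: nondecreasing_einfs.
by have [_ /= [n /= N0n <-] unl] := ereal_inf_lt h; exists n.
Qed.

(** Fatou bounds the mean of [liminf_N G r N] by [g r]; the sum over [r] of these liminfs is then
    integrable, hence finite almost everywhere. The window [N] at which the bound holds may depend
    on [r] and [w], which is harmless for passing to a limit in [N]. *)
Lemma ae_summable_liminf (G : nat -> nat -> T -> R) (g : nat -> R) :
  (forall r N w, 0 <= G r N w) -> (forall r N, L1 (G r N)) ->
  (forall r N, Ex (G r N) <= g r) -> cvgn (series g) ->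
  {ae P, forall w, exists2 F : nat -> R, cvgn (series F) &
    forall r N0, exists2 N, (N0 <= N)%N & G r N w <= F r}.
Proof.
move=> G0 IG Gg cg.
pose u r w : \bar R := limn_einf (fun N => (G r N w)%:E).
have mG r N : measurable_fun setT (fun w => (G r N w)%:E).
  by apply/measurable_EFinP; exact: L1_measurable (IG r N).
have g0 r : 0 <= g r by apply: le_trans (Gg r 0%N); exact: Ex_ge0.
have u0 r w : (0 <= u r w)%E.
  rewrite /u limn_einf_lim; apply: lime_ge; first exact: is_cvg_einfs.
  by apply: nearW => n; apply: le_ereal_inf_tmp => _ [m _ <-]; rewrite lee_fin.
have mu r : measurable_fun setT (u r).
  apply: (measurableT_comp (f := @oppe R) (g := fun w => limn_esup (fun N => - (G r N w)%:E)%E)) => //.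
  by apply: measurable_fun_limn_esup => n; exact: measurableT_comp.
have iu r : (\int[P]_w u r w <= (g r)%:E)%E.
  apply: (le_trans (fatou P measurableT (mG r) (fun N w _ => ltac:(by rewrite lee_fin)))).
  by apply: limn_einf_ub => N; rewrite L1_Ex// lee_fin.
have su0 w : (0 <= \sum_(r <oo) u r w)%E by exact: nneseries_ge0.
have msu : measurable_fun setT (fun w => \sum_(r <oo) u r w)%E.
  by apply: ge0_emeasurable_sum.
have : P.-integrable setT (fun w => \sum_(r <oo) u r w)%E.
  apply/integrableP; split=> //.
  under eq_integral do rewrite gee0_abs//.
  rewrite integral_nneseries//.
  apply: (@le_lt_trans _ _ (\sum_(r <oo) (g r)%:E)%E).
    by apply: lee_nneseries => [r _ _|r _]; [exact: integral_ge0|exact: iu].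
  rewrite (_ : (fun n => _) = EFin \o series g).
    by rewrite EFin_lim// ltry.
  by apply/funext => n /=; rewrite sumEFin.
move=> /(integrable_ae measurableT); apply: filterS => w /(_ I) fw.
have finu r : u r w \is a fin_num.
  rewrite ge0_fin_numE// ltey; apply: contraTneq fw => ur.
  by rewrite (nneseries_pinfty _ _ ur).
(* The summable margin [2^(-r)] puts [F r] strictly above the liminf, so that [G r N w] falls below
   it for arbitrarily large [N]. *)
exists (fun r => fine (u r w) + geometric 1 2^-1 r).
  apply: is_cvg_seriesD; last first.
    by apply: is_cvg_geometric_series; rewrite ger0_norm// invf_lt1// ltr1n.
  apply: nondecreasing_is_cvgn.
    by apply: nondecreasing_series => n _ _; exact: fine_ge0.
  exists (fine (\sum_(r <oo) u r w)%E) => _ [n _ <-].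
  rewrite -lee_fin fineK//.
  apply: le_trans (nneseries_lim_ge n (fun r _ _ => u0 r w)).
  rewrite /series/= -sumEFin; apply: lee_sum => i _; rewrite fineK//.
move=> r N0.
have : (u r w < (fine (u r w) + geometric 1 2^-1 r)%:E)%E.
  by rewrite EFinD fineK// lteDl// lte_fin /geometric/= mul1r exprn_gt0.
move=> /limn_einf_frequently /(_ N0)[N N0N]; rewrite lte_fin => /ltW ?.
by exists N.
Qed.

End second_moments.

Section dyadic_limits.
Context {R : realType}.

(** The subsequence along powers of 2 converges by absolute summability of its increments, and the
    oscillation inside a block is at most [g r], which tends to 0. *)
Lemma cvgn_dyadic_osc (s g : nat -> R) : cvgn (series g) ->
  (forall r m, (2 ^ r <= m)%N -> (m <= 2 ^ r.+1)%N -> `|s m - s (2 ^ r)%N| <= g r) ->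
  cvgn s.
Proof.
move=> cg sg.
have g0 r : 0 <= g r.
  by apply: le_trans (sg r (2 ^ r)%N _ _) => //; rewrite leq_exp2l.
have : cvgn (series (fun r => s (2 ^ r.+1)%N - s (2 ^ r)%N)).
  apply: normed_cvg; apply: (series_le_cvg _ g0 _ cg) => r; first exact: normr_ge0.
  by apply: sg => //; rewrite leq_exp2l.
move=> /cvg_ex[l hl].
have cs : s (2 ^ r)%N @[r --> \oo] --> s 1%N + l.
  have -> : (fun r => s (2 ^ r)%N) =
      (fun r => s 1%N + series (fun r => s (2 ^ r.+1)%N - s (2 ^ r)%N) r).
    apply/funext => r; rewrite /series/= telescope_sumr// expn0; ring.
  by apply: cvgD hl; exact: cvg_cst.
have cg0 : g @ \oo --> (0 : R) by exact: cvg_series_cvg_0.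
apply/cvg_ex; exists (s 1%N + l); apply/cvgrPdist_lt => e e0.
have e2 : 0 < e / 2 by rewrite divr_gt0.
have /cvgrPdist_lt /(_ _ e2)[r1 _ h1] := cs.
have /cvgrPdist_lt /(_ _ e2)[r2 _ h2] := cg0.
exists (2 ^ maxn r1 r2)%N => // m /= hm.
have m0 : (0 < m)%N by apply: leq_trans hm; rewrite expn_gt0.
pose r := trunc_log 2 m.
have /andP[rm mr] : (2 ^ r <= m < 2 ^ r.+1)%N by exact: trunc_log_bounds.
have hr : (maxn r1 r2 <= r)%N by rewrite -ltnS -(ltn_exp2l _ _ (ltnSn 1)) (leq_ltn_trans hm).
have := h1 r (leq_trans (leq_maxl _ _) hr); have := h2 r (leq_trans (leq_maxr _ _) hr).
rewrite sub0r normrN (ger0_norm (g0 r)) => a1 a2.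
have a3 := sg r m rm (ltnW mr).
rewrite (_ : _ - _ = (s 1%N + l - s (2 ^ r)%N) - (s m - s (2 ^ r)%N)); last by ring.
apply: (le_lt_trans (ler_normB _ _)); lra.
Qed.

End dyadic_limits.

(** * Almost sure statements from block second moments *)

Section almost_sure_limits.
Context d (T : measurableType d) (R : realType) (P : probability T R).
Local Notation L1 := (L1 P).
Local Notation Ex := (Ex P).

(** On the block from [2^r] to [2^(r+1)] the chaining functional has mean at most [K (r+1) rho^r];
    the geometric decay beats the logarithmic losses. *)
Lemma ae_cvgn_dyadic (S : nat -> T -> R) (K rho : R) : 0 <= K -> 0 < rho < 1 ->
  (forall r x y, (2 ^ r <= x)%N -> (x <= y)%N -> (y <= 2 ^ r.+1)%N ->
    L1 (fun w => (S y w - S x w) ^+ 2) /\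
    Ex (fun w => (S y w - S x w) ^+ 2) <= K * (rho / 2) ^+ r * (y - x)%:R) ->
  {ae P, forall w, cvgn (S^~ w)}.
Proof.
move=> K0 /andP[r0 r1] H.
pose t := Num.sqrt rho.
have t0 : 0 < t by rewrite sqrtr_gt0.
have tt : t ^+ 2 = rho by rewrite sqr_sqrtr// ltW.
have t1 : t < 1 by rewrite -sqrtr1 ltr_sqrt.
have HQ r : L1 (fun w => dyadicQ r (2 ^ r) (S^~ w)) /\
    Ex (fun w => dyadicQ r (2 ^ r) (S^~ w)) <=
      K * (rho / 2) ^+ r * (r.+1%:R * (2 ^ r)%:R).
  apply: Ex_dyadicQ; first by rewrite mulr_ge0// exprn_ge0// divr_ge0// ltW.
  by move=> x y xa xy yb; apply: (H r) => //; rewrite expnS mul2n -addnn.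
(* Half of the decay, [t^r], is spent as threshold in [sqrt_bound]; the other half makes the means
   [K (r+1)^2 t^r] summable. There is no window here, so [N] is a dummy. *)
pose G r (N : nat) w := (r.+1%:R / t ^+ r) * dyadicQ r (2 ^ r) (S^~ w).
have c0 r : 0 <= r.+1%:R / t ^+ r by rewrite divr_ge0// exprn_ge0// ltW.
have := @ae_summable_liminf _ _ _ P G (fun r => K * (r.+1%:R ^+ 2 * t ^+ r)).
case.
- by move=> r N w; rewrite mulr_ge0// dyadicQ_ge0.
- by move=> r N; apply: L1Z; have [] := HQ r.
- move=> r N; have [IQ EQ] := HQ r.
  rewrite ExZ//; apply: (le_trans (ler_wpM2l (c0 r) EQ)).
  rewrite le_eqVlt; apply/orP; left; apply/eqP.
  rewrite expr_div_n -tt -exprM mulnC exprM natrX; field.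
  by rewrite !expf_neq0// gt_eqF.
- by apply: cvg_series_succ_sqr_geometric; rewrite t0 t1.
move=> A [mA A0 hA]; exists A; split => // w /= nc; apply: hA => /=.
move=> [F cF GF]; apply: nc.
apply: (@cvgn_dyadic_osc _ _ (fun r => geometric 1 t r + F r)).
  apply: is_cvg_seriesD => //.
  by apply: is_cvg_geometric_series; rewrite ger0_norm// ltW.
move=> r m rm mr.
have tr0 : 0 < t ^+ r by rewrite exprn_gt0.
apply: (le_trans (sqrt_bound _ tr0)).
rewrite /geometric/= mul1r lerD2l.
have [N _] := GF r 0%N; apply: le_trans.
rewrite /G [leRHS]mulrAC ler_wpM2r ?invr_ge0 ?(ltW tr0)//.
have hm : (m - 2 ^ r <= 2 ^ r)%N by rewrite leq_subLR addnn -mul2n -expnS.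
have := dyadicQ_max (2 ^ r) (S^~ w) hm; rewrite subnKC//.
Qed.

(** [W n] is the process of interest and [S N n] its approximation with window [N]. At level [r],
    [U r N] is the part handled by chaining and [B r N] dominates the error for all [n <= 2^r] at
    once. The two rate conditions say that the variance over a block and the L^1 error are smaller
    than [2^(2r/p)] and [2^(r/p)] by a geometric factor. *)
Lemma ae_marcinkiewicz (U : nat -> nat -> nat -> T -> R) (B : nat -> nat -> T -> R)
    (S : nat -> nat -> T -> R) (W : nat -> T -> R) (k b : nat -> R) (p K rho : R) :
  0 < p -> 0 <= K -> 0 < rho < 1 -> (forall r, 0 <= k r) ->
  (forall r N w, U r N 0 w = 0) ->
  (forall r N x y, (x <= y)%N -> (y <= 2 ^ r)%N ->
    L1 (fun w => (U r N y w - U r N x w) ^+ 2) /\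
    Ex (fun w => (U r N y w - U r N x w) ^+ 2) <= k r * (y - x)%:R) ->
  (forall r N w, 0 <= B r N w) -> (forall r N, L1 (B r N)) ->
  (forall r N, Ex (B r N) <= b r) ->
  (forall r N n w, (n <= 2 ^ r)%N -> `|S N n w - U r N n w| <= B r N w) ->
  (forall r, k r * 2 ^+ r <= K * rho ^+ r * ((2 `^ p^-1) ^+ r) ^+ 2) ->
  (forall r, b r <= K * rho ^+ r * (2 `^ p^-1) ^+ r) ->
  {ae P, forall w n, S N n w @[N --> \oo] --> W n w} ->
  {ae P, forall w, W n w / n%:R `^ p^-1 @[n --> \oo] --> (0 : R)}.
Proof.
move=> p0 K0 rho01 k0 U0 HU B0 IB EB SU kK bK.
pose h : R := 2 `^ p^-1.
have h0 : 0 < h by rewrite powR_gt0.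
have hr0 r : 0 < h ^+ r by rewrite exprn_gt0.
pose Q r N w := dyadicQ r 0 (fun n => U r N n w).
have HQ r N : L1 (Q r N) /\ Ex (Q r N) <= k r * (r.+1%:R * (2 ^ r)%:R).
  by apply: Ex_dyadicQ => // x y _ xy yb; exact: HU.
(* The factor [r+1] is the loss in [dyadicQ_max], so [c r * Q r N w] dominates the normalised
   squares of [U r N n w]. *)
pose c r := r.+1%:R / (h ^+ r) ^+ 2.
have c0 r : 0 <= c r by rewrite divr_ge0// exprn_ge0// ltW.
pose G r N w := c r * Q r N w + (h ^+ r)^-1 * B r N w.
have G0 r N w : 0 <= G r N w.
  by apply: addr_ge0; apply: mulr_ge0 => //; [exact: dyadicQ_ge0|rewrite invr_ge0 ltW].
have rho0 r : 0 <= rho ^+ r by rewrite exprn_ge0// ltW//; case/andP: rho01.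
have := @ae_summable_liminf _ _ _ P G (fun r => (2 * K) * (r.+1%:R ^+ 2 * rho ^+ r)).
case=> //.
- by move=> r N; apply: L1D; apply: L1Z => //; have [] := HQ r N.
- move=> r N; have [IQ EQ] := HQ r N.
  rewrite ExD ?ExZ//; [|exact: L1Z|exact: L1Z].
  have -> : 2 * K * (r.+1%:R ^+ 2 * rho ^+ r) =
      K * (r.+1%:R ^+ 2 * rho ^+ r) + K * (r.+1%:R ^+ 2 * rho ^+ r) by ring.
  apply: lerD.
    apply: (le_trans (ler_wpM2l (c0 r) EQ)).
    rewrite /c mulrAC ler_pdivrMr ?exprn_gt0//.
    have := kK r; rewrite -/h natrX => kKr.
    move: kKr; set a := r.+1%:R; set q := 2 ^+ r => kKr.
    rewrite [leLHS](_ : _ = a ^+ 2 * (k r * q)); last by ring.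
    apply: (le_trans (ler_wpM2l (sqr_ge0 _) kKr)).
    by rewrite le_eqVlt; apply/orP; left; apply/eqP; ring.
  rewrite mulrC ler_pdivrMr//; apply: (le_trans (EB r N)); apply: (le_trans (bK r)).
  rewrite ler_wpM2r ?(ltW (hr0 _))// ler_wpM2l// ler_peMl//.
  by rewrite -natrX ler1n expn_gt0.
- exact: cvg_series_succ_sqr_geometric.
move=> A [mA A0 hA] [A' [mA' A'0 hA']].
exists (A `|` A'); split.
- exact: measurableU.
- by apply/eqP; rewrite eq_le measure_ge0 andbT -(adde0 0%E) -{1}A0 -A'0 measureU2.
move=> w /= nc; apply: contrapT => /not_orP[nA nA']; apply: nc.
have {hA nA} [F cF GF] : exists2 F : nat -> R, cvgn (series F) &
    forall r N0, exists2 N, (N0 <= N)%N & G r N w <= F r.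
  by apply: contrapT => H; apply: nA; exact: hA.
have {hA' nA'} SW : forall n, S N n w @[N --> \oo] --> W n w.
  by apply: contrapT => H; apply: nA'; exact: hA'.
(* For given [r] and [n], a window [N] is chosen where [S N n w] is within [dl] of its limit and
   [G r N w <= F r]. The condition [e <= 1] allows [B] to be divided by [e] as well, giving one
   common bound. *)
have Wbound (e : R) r n : 0 < e -> e <= 1 -> (n <= 2 ^ r)%N ->
    `|W n w| <= h ^+ r * (e + F r / e).
  move=> e0 e1 nr; apply/ler_addgt0Pr => dl dl0.
  have /cvgrPdist_lt /(_ _ dl0)[N0 _ hN0] := (SW n).
  have [N N0N GN] := GF r N0.
  have SN : `|S N n w| <= h ^+ r * (e + G r N w / e).
    have -> : S N n w = U r N n w + (S N n w - U r N n w) by ring.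
    apply: (le_trans (ler_normD _ _)).
    have eh : 0 < e * h ^+ r by rewrite mulr_gt0.
    have b1 := sqrt_bound (U r N n w) eh.
    have b2 := SU r N n w nr.
    have b3 : U r N n w ^+ 2 <= r.+1%:R * Q r N w.
      have := @dyadicQ_max _ r 0 (fun n => U r N n w) n nr.
      by rewrite add0n U0 subr0.
    apply: (le_trans (lerD b1 b2)).
    have b4 : U r N n w ^+ 2 / (e * h ^+ r) <= h ^+ r * (c r * Q r N w / e).
      rewrite ler_pdivrMr//; apply: (le_trans b3).
      rewrite le_eqVlt; apply/orP; left; apply/eqP; rewrite /c; field.
      by rewrite !gt_eqF.
    have b5 : B r N w <= h ^+ r * ((h ^+ r)^-1 * B r N w / e).
      rewrite !mulrA mulfV ?gt_eqF// mul1r ler_peMr// invf_ge1//.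
    rewrite /G mulrDl !mulrDr; rewrite [h ^+ r * e]mulrC; lra.
  have := hN0 N N0N => /ltW Wd.
  have -> : W n w = (W n w - S N n w) + S N n w by ring.
  apply: (le_trans (ler_normD _ _)); rewrite addrC; apply: lerD => //.
  apply: (le_trans SN); rewrite ler_wpM2l ?(ltW (hr0 _))// lerD2l ler_wpM2r ?invr_ge0 ?(ltW e0)//.
have F0 : F @ \oo --> (0 : R) by exact: cvg_series_cvg_0.
apply/cvgrPdist_lt => e e0.
(* For [2^r <= n < 2^(r+1)] the bound is used at level [r+1], which costs one extra factor [h]. Once
   [F r.+1 <= e1^2], both terms of the bound are at most [e1], and [2 h e1 < e]. *)
pose e1 := Num.min 1 (e / (4 * h)).
have e10 : 0 < e1 by rewrite lt_min ltr01 divr_gt0// mulr_gt0.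
have e11 : e1 <= 1 by rewrite ge_min lexx.
have e12 : e1 * (4 * h) <= e by rewrite -ler_pdivlMr ?mulr_gt0// ge_min lexx orbT.
have /cvgrPdist_lt /(_ _ (exprn_gt0 2 e10))[r0 _ hr] := F0.
exists (2 ^ r0)%N => // n /= hn.
have n0 : (0 < n)%N by apply: leq_trans hn; rewrite expn_gt0.
pose r := trunc_log 2 n.
have /andP[rn nr] : (2 ^ r <= n < 2 ^ r.+1)%N by exact: trunc_log_bounds.
have hr0r : (r0 <= r)%N by rewrite -ltnS -(ltn_exp2l _ _ (ltnSn 1)) (leq_ltn_trans hn).
have := hr r.+1 (leqW hr0r); rewrite sub0r normrN => Fr.
have Fr' : F r.+1 / e1 <= e1.
  by rewrite ler_pdivrMr// -expr2; apply: le_trans (ltW Fr); exact: ler_norm.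
have := Wbound _ r.+1 n e10 e11 (ltnW nr) => Wn.
have np : 0 < n%:R `^ p^-1 :> R by rewrite powR_gt0// ltr0n.
have hrn : h ^+ r <= n%:R `^ p^-1.
  rewrite /h -powR_mulrn ?powR_ge0// -powRrM mulrC powRrM powR_mulrn//.
  by rewrite ge0_ler_powR ?invr_ge0 ?(ltW p0)// ?nnegrE// -natrX ler_nat.
rewrite sub0r normrN normrM normfV (gtr0_norm np) ltr_pdivrMr//.
apply: (le_lt_trans Wn).
apply: (@le_lt_trans _ _ ((h * n%:R `^ p^-1) * (e1 + e1))).
  apply: ler_pM; first by rewrite exprn_ge0// ltW.
  - rewrite -(@pmulr_lge0 _ (h ^+ r.+1)) 1?mulrC//.
    by apply: le_trans Wn; exact: normr_ge0.
  - by rewrite exprS ler_pM2l.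
  - by rewrite lerD2l.
rewrite mulrAC ltr_pM2r//.
have : 0 < e1 * h by rewrite mulr_gt0.
nra.
Qed.

End almost_sure_limits.

(** * Coefficients *)

Section zrange.
Context {R : realType}.
Implicit Types (f : int -> R).

Lemma mem_zrange N (l : int) : (l \in zrange N) = (`|l|%N <= N)%N.
Proof.
apply/mapP/idP => [[i]|lN].
  by rewrite mem_iota => iN ->; lia.
exists (absz (l + N%:Z)); first by rewrite mem_iota; lia.
lia.
Qed.

Lemma uniq_zrange N : uniq (zrange N).
Proof. by rewrite map_inj_uniq ?iota_uniq// => i j; lia. Qed.

Lemma sum_zrangeS N f :
  \sum_(l <- zrange N.+1) f l = \sum_(l <- zrange N) f l + f N.+1%:Z + f (- N.+1%:Z).
Proof.
have -> : \sum_(l <- zrange N.+1) f l =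
    \sum_(l <- [:: N.+1%:Z, - N.+1%:Z & zrange N]) f l.
  apply: perm_big; apply: uniq_perm; first exact: uniq_zrange.
    by rewrite 2!cons_uniq uniq_zrange inE !mem_zrange; lia.
  by move=> l; rewrite mem_zrange (in_cons N.+1%:Z) (in_cons (- N.+1%:Z)) mem_zrange; lia.
by rewrite 2!big_cons; ring.
Qed.

Lemma sum_zrange0 f : \sum_(l <- zrange 0) f l = f 0.
Proof. by rewrite /zrange muln0/= big_seq1 subrr. Qed.

Lemma ler_sum_zrange (s : seq int) f (Z : R) : uniq s -> (forall l, 0 <= f l) ->
  (forall N, \sum_(l <- zrange N) f l <= Z) -> \sum_(l <- s) f l <= Z.
Proof.
move=> us f0 fZ.
pose N := \max_(l <- s) `|l|%N.
have sN : {subset s <= zrange N}.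
  by move=> l ls; rewrite mem_zrange; exact: (@leq_bigmax_seq _ s xpredT (fun l : int => absz l) l ls isT).
apply: le_trans (fZ N).
rewrite [leRHS](bigID (mem s))/= -[X in _ <= X + _]big_filter.
have pe : perm_eq [seq l <- zrange N | l \in s] s.
  apply: uniq_perm => //; first exact: filter_uniq (uniq_zrange N).
  by move=> l; rewrite mem_filter andb_idr//; exact: sN.
by rewrite (perm_big _ pe)/= lerDl sumr_ge0.
Qed.

Lemma sum_zrangeN N f : \sum_(l <- zrange N) f (- l) = \sum_(l <- zrange N) f l.
Proof.
elim: N => [|N ih]; first by rewrite !sum_zrange0 oppr0.
by rewrite !sum_zrangeS ih opprK; ring.
Qed.

Lemma sum_zrange_shift N f :
  \sum_(l <- zrange N) f (l + 1) = \sum_(l <- zrange N) f l + f N.+1%:Z - f (- N%:Z).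
Proof.
elim: N => [|N ih]; first by rewrite !sum_zrange0 oppr0 add0r; ring.
rewrite !sum_zrangeS ih.
have -> : N.+1%:Z + 1 = N.+2%:Z by lia.
have -> : - N.+1%:Z + 1 = - N%:Z by lia.
ring.
Qed.

End zrange.

Section weights.
Context {R : realType}.

(** [1 + |l|] instead of [|l|], so that negative powers behave at [l = 0]. *)
Definition wgt (l : int) : R := `|l|%N.+1%:R.

Lemma wgt_ge1 l : 1 <= wgt l.
Proof. by rewrite ler1n. Qed.

Lemma wgt_gt0 l : 0 < wgt l.
Proof. by rewrite ltr0n. Qed.

Lemma wgtN l : wgt (- l) = wgt l.
Proof. by rewrite /wgt abszN. Qed.

(** Cauchy condensation: the terms of index [2^r] to [2^(r+1) - 1] add up to at most [rho^r] with
    [rho = 2^(1 - tau) < 1]. The factor 2 in the bound accounts for the two signs. *)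
Lemma summable_wgt (tau : R) : 1 < tau ->
  exists2 Z, 0 <= Z & forall s : seq int, uniq s -> \sum_(l <- s) wgt l `^ (- tau) <= Z.
Proof.
move=> t1.
pose rho : R := 2 `^ (1 - tau).
have rho0 : 0 < rho by rewrite powR_gt0.
have rho1 : rho < 1.
  rewrite /rho -opprB powRN invf_lt1 ?powR_gt0// -[ltLHS](powRr0 2).
  by rewrite /powR pnatr_eq0/= ltr_expR mul0r mulr_gt0 ?subr_gt0 ?ln_gt0// ltr1n.
pose a n : R := n.+1%:R `^ (- tau).
have a_ge0 n : 0 <= a n by exact: powR_ge0.
have a_dec m n : (m <= n)%N -> a n <= a m.
  move=> mn; rewrite /a !powRN lef_pV2 ?posrE ?powR_gt0 ?ltr0n//.
  by apply: ge0_ler_powR; rewrite ?nnegrE ?ler_nat ?ler0n//; apply: ltW; apply: lt_trans t1.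
pose A := (1 - rho)^-1.
have A0 : 0 < A by rewrite invr_gt0 subr_gt0.
have AE : A = 1 + rho * A by rewrite /A; field; rewrite subr_eq0 eq_sym lt_eqF.
have dy r : \sum_(0 <= i < 2 ^ r) a i <= 1 + A * (1 - rho ^+ r).
  elim: r => [|r ih].
    by rewrite expn0 big_nat1 expr0 subrr mulr0 addr0 /a powR1.
  rewrite (@big_cat_nat _ _ _ (2 ^ r))//= ?leq_exp2l//.
  apply: (@le_trans _ _ (1 + A * (1 - rho ^+ r) + rho ^+ r)).
    apply: lerD => //.
    apply: (@le_trans _ _ (\sum_(2 ^ r <= i < 2 ^ r.+1) (2 ^ r)%:R `^ (- tau))).
      rewrite big_nat_cond [leRHS]big_nat_cond; apply: ler_sum => i /andP[/andP[ri _] _].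
      rewrite /a !powRN lef_pV2 ?posrE ?powR_gt0 ?ltr0n ?expn_gt0//.
      apply: ge0_ler_powR; rewrite ?nnegrE ?ler_nat ?ler0n//; last exact: leqW.
      by apply: ltW; apply: lt_trans t1.
    rewrite sumr_const_nat expnS mul2n -addnn addnK.
    have h2 : 2 ^+ r = 2 `^ r%:R :> R by rewrite powR_mulrn.
    have h3 : rho ^+ r = 2 `^ (r%:R * (1 - tau)).
      by rewrite mulrC powRrM powR_mulrn ?powR_ge0.
    rewrite -[_ `^ _ *+ _]mulr_natl natrX h2 h3 -powRrM -powRD ?pnatr_eq0 ?implybT//.
    by rewrite le_eqVlt; apply/orP; left; apply/eqP; congr (_ `^ _); ring.
  rewrite exprS {1}AE.
  have : A * (1 - rho) = 1 by rewrite /A mulVf// subr_eq0 eq_sym lt_eqF.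
  have : 0 <= rho ^+ r by rewrite exprn_ge0// ltW.
  set q := rho ^+ r => q0 h.
  rewrite -AE -subr_ge0 [X in 0 <= X](_ : _ = q * (A * (1 - rho)) - q); last by ring.
  by rewrite h mulr1 subrr.
exists (2 * (1 + A)); first by rewrite mulr_ge0// addr_ge0// ltW.
move=> s us; apply: ler_sum_zrange => // [l|N]; first exact: powR_ge0.
have h : \sum_(l <- zrange N) wgt l `^ (- tau) <= 2 * \sum_(0 <= i < N.+1) a i.
  elim: N => [|N ih].
    by rewrite sum_zrange0 big_nat1 /wgt -/(a 0%N) ler_peMl// ler1n.
  rewrite sum_zrangeS big_nat_recr//= wgtN /wgt -/(a N.+1); lra.
apply: (le_trans h); rewrite ler_pM2l//.
apply: (@le_trans _ _ (\sum_(0 <= i < 2 ^ N.+1) a i)).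
  rewrite [leRHS](@big_cat_nat _ _ _ N.+1)//=; last exact/ltnW/ltn_expl.
  by rewrite lerDl sumr_ge0.
apply: (le_trans (dy _)); rewrite lerD2l ler_piMr ?(ltW A0)// gerBl exprn_ge0// ltW//.
Qed.

(** Of the two weights, the larger is at least half of [wgt (h1 - h2)]. It pays for the decay in
    [h1 - h2] with exponent [th], and what remains of it is transferred to the smaller weight, whose
    exponent becomes [1 + eps], just summable. The loss [eps] also covers the logarithm that appears
    at [sigma = 1]. *)
Lemma wgt_convolution (sigma eps : R) : 0 < eps -> eps <= 2 * sigma - 1 -> sigma <= 1 ->
  exists2 K, 0 <= K & forall (h1 h2 : int) (s : seq int), uniq s ->
    \sum_(l <- s) wgt (h1 - l) `^ (- sigma) * wgt (h2 - l) `^ (- sigma) <=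
    K * wgt (h1 - h2) `^ (- (2 * sigma - 1 - eps)).
Proof.
move=> e0 es s1.
have [|Z Z0 hZ] := @summable_wgt (1 + eps); first by rewrite ltrDl.
pose th := 2 * sigma - 1 - eps.
have th0 : 0 <= th by rewrite subr_ge0.
(* [sigma - th = 1 - sigma + eps]: here [sigma <= 1] enters, and it allows the leftover power of the
   larger weight to be bounded by that of the smaller. *)
have st0 : 0 <= sigma - th by rewrite /th; lra.
have pw (a b H : R) : 1 <= a -> 1 <= b -> 0 < H -> H <= a + b -> a <= b ->
    a `^ (- sigma) * b `^ (- sigma) <= 2 `^ th * H `^ (- th) * a `^ (- (1 + eps)).
  move=> a1 b1 H0 Hab ab.
  have a0 : 0 < a by apply: lt_le_trans a1.
  have b0 : 0 < b by apply: lt_le_trans b1.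
  have hb : b `^ (- sigma) = b `^ (- th) * b `^ (- (sigma - th)).
    by rewrite -powRD ?(gt_eqF b0) ?implybT//; congr (_ `^ _); ring.
  have ha : a `^ (- (1 + eps)) = a `^ (- (sigma - th)) * a `^ (- sigma).
    by rewrite -powRD ?(gt_eqF a0) ?implybT//; congr (_ `^ _); rewrite /th; ring.
  rewrite hb ha mulrC [leRHS]mulrA.
  rewrite ler_wpM2r ?powR_ge0//; apply: ler_pM; rewrite ?powR_ge0//.
    have -> : 2 `^ th = 2^-1 `^ (- th) :> R.
      by rewrite -[2^-1]powR_inv1// -powRrM mulN1r opprK.
    rewrite -powRM ?invr_ge0 ?(ltW H0)// !powRN lef_pV2 ?posrE ?powR_gt0 ?mulr_gt0 ?invr_gt0//.
    by apply: ge0_ler_powR; rewrite ?nnegrE ?mulr_ge0 ?invr_ge0 ?(ltW H0) ?(ltW b0)//; lra.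
  rewrite !powRN lef_pV2 ?posrE ?powR_gt0//.
  by apply: ge0_ler_powR; rewrite ?nnegrE ?(ltW a0) ?(ltW b0).
exists (2 `^ th * (Z + Z)); first by rewrite mulr_ge0 ?powR_ge0 ?addr_ge0.
move=> h1 h2 s us.
set H := wgt (h1 - h2).
have Hs (h : int) : \sum_(l <- s) wgt (h - l) `^ (- (1 + eps)) <= Z.
  have := hZ [seq h - l | l <- s]; rewrite big_map; apply.
  by rewrite map_inj_uniq// => x y; lia.
apply: (@le_trans _ _ (\sum_(l <- s) (2 `^ th * H `^ (- th)) *
   (wgt (h1 - l) `^ (- (1 + eps)) + wgt (h2 - l) `^ (- (1 + eps))))).
  apply: ler_sum => l _.
  have Hab : H <= wgt (h1 - l) + wgt (h2 - l).
    by rewrite /H /wgt -natrD ler_nat; lia.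
  have c0 : 0 <= 2 `^ th * H `^ (- th) by rewrite mulr_ge0 ?powR_ge0.
  rewrite mulrDr.
  have [ab|/ltW ba] := leP (wgt (h1 - l)) (wgt (h2 - l)).
    apply: (le_trans (pw _ _ H (wgt_ge1 _) (wgt_ge1 _) (wgt_gt0 _) Hab ab)).
    by rewrite lerDl mulr_ge0 ?powR_ge0.
  rewrite mulrC; rewrite addrC in Hab.
  apply: (le_trans (pw _ _ H (wgt_ge1 _) (wgt_ge1 _) (wgt_gt0 _) Hab ba)).
  by rewrite lerDr mulr_ge0 ?powR_ge0.
rewrite -mulr_sumr big_split/= [leRHS]mulrAC ler_wpM2l ?mulr_ge0 ?powR_ge0//.
exact: lerD.
Qed.

End weights.

Section coefficients.
Context {R : realType}.
Implicit Types (c cb a : int -> R).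

Lemma coef_wgt_bound c (sigma : R) : 0 < sigma ->
  (exists C : R, forall l : int, `|(l%:~R : R)| `^ sigma * `|c l| <= C) ->
  exists2 C, 0 <= C & forall l, `|c l| <= C * wgt l `^ (- sigma).
Proof.
move=> s0 [C hC].
have C0 : 0 <= C by apply: le_trans (hC 0); rewrite mulr_ge0 ?powR_ge0.
(* The hypothesis says nothing about [c 0], which is added by hand; [2^sigma] comes from
   [1 + |l| <= 2 |l|] for [l] nonzero. *)
exists (`|c 0| + 2 `^ sigma * C); first by rewrite addr_ge0 ?mulr_ge0 ?powR_ge0.
move=> l; have [->|l0] := eqVneq l 0.
  by rewrite /wgt absz0 powR1 mulr1 lerDl mulr_ge0 ?powR_ge0.
have w0 : 0 < wgt l `^ sigma :> R by rewrite powR_gt0 ?wgt_gt0.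
rewrite powRN ler_pdivlMr// mulrC.
apply: (@le_trans _ _ (2 `^ sigma * C)); last by rewrite lerDr.
apply: (@le_trans _ _ ((2 `^ sigma * `|(l%:~R : R)| `^ sigma) * `|c l|)).
  rewrite ler_wpM2r// -powRM//; apply: ge0_ler_powR; rewrite ?nnegrE ?(ltW s0)//.
  rewrite -intr_norm -abszE /wgt -natrM ler_nat; lia.
by rewrite -mulrA ler_wpM2l ?powR_ge0.
Qed.

(** Opening the square and summing over [l] and [m] first decouples them, leaving products of two
    correlations between times [j] and [k]. *)
Lemma sum_sqr_exchange (I J : Type) (s : seq I) (t : seq J) (u v : J -> I -> R) :
  \sum_(l <- s) \sum_(m <- s) (\sum_(j <- t) u j l * v j m) ^+ 2 =
  \sum_(j <- t) \sum_(k <- t)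
    (\sum_(l <- s) u j l * u k l) * (\sum_(m <- s) v j m * v k m).
Proof.
transitivity (\sum_(l <- s) \sum_(m <- s) \sum_(j <- t) \sum_(k <- t)
    (u j l * u k l) * (v j m * v k m)).
  apply: eq_bigr => l _; apply: eq_bigr => m _.
  rewrite expr2 big_distrlr/=; apply: eq_bigr => j _; apply: eq_bigr => k _; ring.
under eq_bigr do rewrite exchange_big/=.
rewrite exchange_big/=; apply: eq_bigr => j _.
under eq_bigr do rewrite exchange_big/=.
rewrite exchange_big/=; apply: eq_bigr => k _.
by rewrite big_distrlr.
Qed.

(** Each correlation decays in the lag [j - k] by [wgt_convolution]. Their product need not be
    summable in the lag; since lags in the block have weight at most [2^r], a factor [2^(kappa r)]
    buys the missing decay. *)
Lemma block_coef_bound c cb (C Cb sigma sigmab kappa : R) :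
  1 / 2 < sigma <= 1 -> 1 / 2 < sigmab <= 1 -> 0 <= kappa ->
  3 - 2 * sigma - 2 * sigmab < kappa ->
  0 <= C -> 0 <= Cb ->
  (forall l, `|c l| <= C * wgt l `^ (- sigma)) ->
  (forall l, `|cb l| <= Cb * wgt l `^ (- sigmab)) ->
  exists2 K, 0 <= K & forall r x y (s : seq int), uniq s -> (x <= y)%N -> (y <= 2 ^ r)%N ->
    \sum_(l <- s) \sum_(m <- s) (\sum_(x <= k < y) c (k.+1%:Z - l) * cb (k.+1%:Z - m)) ^+ 2
    <= K * (2 `^ kappa) ^+ r * (y - x)%:R.
Proof.
move=> /andP[s0 s1] /andP[sb0 sb1] k0 hk C0 Cb0 hc hcb.
(* Small enough for both convolutions, and with [2 eps] below the gap in the condition on [kappa],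
   so that [th + thb + kappa > 1]. *)
pose eps := Num.min (Num.min (2 * sigma - 1) (2 * sigmab - 1))
                    ((kappa - (3 - 2 * sigma - 2 * sigmab)) / 4).
have e0 : 0 < eps by rewrite !lt_min; apply/andP; split; [apply/andP; split|]; lra.
have es : eps <= 2 * sigma - 1 by rewrite /eps !ge_min lexx.
have esb : eps <= 2 * sigmab - 1 by rewrite /eps !ge_min lexx orbT.
have ek : eps <= (kappa - (3 - 2 * sigma - 2 * sigmab)) / 4.
  by rewrite /eps !ge_min lexx !orbT.
clearbody eps.
pose th := 2 * sigma - 1 - eps; pose thb := 2 * sigmab - 1 - eps.
have [K K0 hK] := wgt_convolution e0 es s1.
have [Kb Kb0 hKb] := wgt_convolution e0 esb sb1.
have [|Z Z0 hZ] := @summable_wgt R (th + thb + kappa); first by rewrite /th /thb; lra.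
have conv (f : int -> R) (D K' sg th' : R) : 0 <= D -> (forall l, `|f l| <= D * wgt l `^ (- sg)) ->
    (forall (h1 h2 : int) (s : seq int), uniq s ->
    \sum_(l <- s) wgt (h1 - l) `^ (- sg) * wgt (h2 - l) `^ (- sg) <=
    K' * wgt (h1 - h2) `^ (- th')) ->
    forall (h1 h2 : int) (s : seq int), uniq s ->
    `|\sum_(l <- s) f (h1 - l) * f (h2 - l)| <= D ^+ 2 * K' * wgt (h1 - h2) `^ (- th').
  move=> D0 hf hK' h1 h2 s us.
  apply: (le_trans (ler_norm_sum _ _ _)).
  rewrite -mulrA; apply: (le_trans _ (ler_wpM2l (sqr_ge0 D) (hK' h1 h2 s us))).
  rewrite mulr_sumr; apply: ler_sum => l _; rewrite normrM.
  rewrite expr2 mulrACA; exact: ler_pM.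
exists ((C ^+ 2 * K) * (Cb ^+ 2 * Kb) * Z); first by rewrite !mulr_ge0 ?sqr_ge0.
move=> r x y s us xy yr.
have kr0 : 0 <= (2 `^ kappa) ^+ r :> R by rewrite exprn_ge0 ?powR_ge0.
rewrite (@sum_sqr_exchange _ _ _ _ (fun k l => c (k.+1%:Z - l)) (fun k m => cb (k.+1%:Z - m))).
have -> : (y - x)%:R = \sum_(x <= j < y) (1 : R) by rewrite sumr_const_nat.
rewrite mulr_sumr big_nat_cond [leRHS]big_nat_cond; apply: ler_sum => j /andP[/andP[xj jy] _].
rewrite mulr1.
apply: (@le_trans _ _ (\sum_(x <= k < y) ((C ^+ 2 * K) * (Cb ^+ 2 * Kb) * (2 `^ kappa) ^+ r)
    * wgt (j.+1%:Z - k.+1%:Z) `^ (- (th + thb + kappa)))).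
  rewrite big_nat_cond [leRHS]big_nat_cond; apply: ler_sum => k /andP[/andP[xk ky] _].
  apply: (le_trans (ler_norm _)); rewrite normrM.
  apply: (le_trans (ler_pM (normr_ge0 _) (normr_ge0 _)
    (conv c C K sigma th C0 hc hK _ _ _ us) (conv cb Cb Kb sigmab thb Cb0 hcb hKb _ _ _ us))).
  set v := wgt _.
  have v0 : 0 < v by exact: wgt_gt0.
  rewrite [leLHS](_ : _ = (C ^+ 2 * K) * (Cb ^+ 2 * Kb) * (v `^ (- th) * v `^ (- thb))); last by ring.
  rewrite -[leRHS]mulrA ler_wpM2l ?mulr_ge0 ?sqr_ge0//.
  rewrite -powRD ?(gt_eqF v0) ?implybT//.
  (* The factor [v^kappa] is bounded by [2^(kappa r)]; the other has a summable exponent. *)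
  have -> : - th - thb = kappa + - (th + thb + kappa) by ring.
  rewrite powRD ?(gt_eqF v0) ?implybT// ler_wpM2r ?powR_ge0//.
  rewrite -powR_mulrn ?powR_ge0// -powRrM mulrC powRrM powR_mulrn//.
  apply: ge0_ler_powR; rewrite ?nnegrE ?(ltW v0)//.
  rewrite /v /wgt -natrX ler_nat; move: yr; move: (2 ^ r)%N => q yr.
  by clear - xj jy xk ky yr; lia.
rewrite -mulr_sumr [leRHS]mulrAC ler_wpM2l//.
  by rewrite !mulr_ge0 ?sqr_ge0.
have := hZ [seq j.+1%:Z - k.+1%:Z | k <- index_iota x y]; rewrite big_map; apply.
by rewrite map_inj_uniq ?iota_uniq// => k k'; clear; lia.
Qed.

Lemma abs_summable_mul c cb (C Cb sigma sigmab : R) :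
  1 / 2 < sigma -> 1 / 2 < sigmab -> 0 <= C -> 0 <= Cb ->
  (forall l, `|c l| <= C * wgt l `^ (- sigma)) ->
  (forall l, `|cb l| <= Cb * wgt l `^ (- sigmab)) ->
  exists2 A, 0 <= A & forall s : seq int, uniq s -> \sum_(l <- s) `|c l * cb l| <= A.
Proof.
move=> s0 sb0 C0 Cb0 hc hcb.
have [|Z Z0 hZ] := @summable_wgt R (sigma + sigmab); first by lra.
exists (C * Cb * Z); first by rewrite !mulr_ge0.
move=> s us; apply: (le_trans _ (ler_wpM2l _ (hZ s us))); last by rewrite mulr_ge0.
rewrite mulr_sumr; apply: ler_sum => l _.
rewrite normrM opprD powRD ?(gt_eqF (wgt_gt0 l)) ?implybT// mulrACA.
exact: ler_pM.
Qed.

Section abs_summable.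
Variables (a : int -> R) (A : R).
Hypothesis A0 : 0 <= A.
Hypothesis aA : forall s : seq int, uniq s -> \sum_(l <- s) `|a l| <= A.

Lemma abs_summable_row (h : int) (s : seq int) : uniq s -> \sum_(l <- s) `|a (h - l)| <= A.
Proof.
move=> us; have := aA (s := [seq h - l | l <- s]); rewrite big_map; apply.
by rewrite map_inj_uniq// => x y; lia.
Qed.

Lemma abs_summable_col (h : int) x y : \sum_(x <= k < y) `|a (k.+1%:Z - h)| <= A.
Proof.
have := aA (s := [seq k.+1%:Z - h | k <- index_iota x y]); rewrite big_map; apply.
by rewrite map_inj_uniq ?iota_uniq// => k k'; clear; lia.
Qed.

Lemma abs_summable_block (s : seq int) x y : uniq s -> (x <= y)%N ->
  \sum_(l <- s) \sum_(x <= k < y) `|a (k.+1%:Z - l)| <= A * (y - x)%:R.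
Proof.
move=> us xy; rewrite exchange_big/= mulr_natr -sumr_const_nat.
by apply: ler_sum => k _; exact: abs_summable_row.
Qed.

(** Schur-type estimate: in each square one factor is bounded by the sum over [k], at most [A], and
    the other is summed over [l] first. *)
Lemma abs_summable_block_sqr (s : seq int) x y : uniq s -> (x <= y)%N ->
  \sum_(l <- s) (\sum_(x <= k < y) a (k.+1%:Z - l)) ^+ 2 <= A ^+ 2 * (y - x)%:R.
Proof.
move=> us xy; rewrite expr2 -mulrA.
apply: (le_trans _ (ler_wpM2l A0 (abs_summable_block us xy))).
rewrite mulr_sumr; apply: ler_sum => l _.
have n0 : 0 <= \sum_(x <= k < y) `|a (k.+1%:Z - l)| by rewrite sumr_ge0.
rewrite -real_normK ?num_real// expr2; apply: ler_pM => //.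
  by apply: (le_trans (ler_norm_sum _ _ _)); exact: abs_summable_col.
exact: ler_norm_sum.
Qed.

(** Moving the window by one changes the sum by two end terms, which tend to 0; induction on [h]
    then gives every shift. The case [h = 0] is the reflection [l -> -l]. *)
Lemma abs_summable_cvg (h : nat) :
  \sum_(l <- zrange N) a (h%:Z - l) @[N --> \oo] --> zseries a.
Proof.
have cva : \sum_(l <- zrange N) a l @[N --> \oo] --> zseries a.
  suff : cvgn (fun N => \sum_(l <- zrange N) a l) by [].
  pose b i := a i.+1%:Z + a (- i.+1%:Z).
  have -> : (fun N => \sum_(l <- zrange N) a l) = (fun N => a 0 + series b N).
    apply/funext; elim=> [|N ih]; first by rewrite sum_zrange0 /series/= big_geq// addr0.
    by rewrite sum_zrangeS ih /series/= big_nat_recr//= /b; ring.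
  apply: is_cvgD; first exact: is_cvg_cst.
  apply: normed_cvg; apply: nondecreasing_is_cvgn.
    by apply: nondecreasing_series => n _ _; exact: normr_ge0.
  exists A => _ [N _ <-].
  apply: (@le_trans _ _ (\sum_(l <- zrange N) `|a l|)); last exact: (aA (uniq_zrange N)).
  rewrite -[leLHS]/(\sum_(0 <= i < N) `|b i|).
  elim: N => [|N ih]; first by rewrite big_geq// sumr_ge0.
  rewrite sum_zrangeS big_nat_recr//= -addrA.
  by apply: lerD => //; exact: ler_normD.
have a0 : a l%:Z @[l --> \oo] --> 0 /\ a (- l%:Z) @[l --> \oo] --> 0.
  have bnd (f : nat -> int) : injective f -> a (f l) @[l --> \oo] --> (0 : R).
    move=> injf; apply: norm_cvg0.
    apply: cvg_series_cvg_0; apply: nondecreasing_is_cvgn; first by apply: nondecreasing_series => n _ _; exact: normr_ge0.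
    exists A => _ [N _ <-]; rewrite /series/=.
    have := aA (s := [seq f k | k <- index_iota 0 N]); rewrite big_map; apply.
    by rewrite map_inj_uniq ?iota_uniq.
  by split; apply: bnd => x y; lia.
elim: h => [|h ih].
  suff -> : (fun N => \sum_(l <- zrange N) a (0%:Z - l)) = (fun N => \sum_(l <- zrange N) a l) by [].
  apply/funext => N; rewrite -[RHS]sum_zrangeN.
  by apply: eq_bigr => l _; congr a; lia.
have -> : (fun N => \sum_(l <- zrange N) a (h.+1%:Z - l)) = (fun N =>
    \sum_(l <- zrange N) a (h%:Z - l) + a (N + h.+1)%N%:Z - a (h%:Z - N%:Z)).
  apply/funext => N.
  rewrite -[LHS]sum_zrangeN -[X in _ = X + _ - _]sum_zrangeN.
  have e1 : \sum_(l <- zrange N) a (h.+1%:Z - - l) = \sum_(l <- zrange N) (fun l => a (h%:Z + l)) (l + 1).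
    by apply: eq_bigr => l _; congr a; lia.
  rewrite e1 (sum_zrange_shift N (fun l => a (h%:Z + l))).
  have -> : \sum_(l <- zrange N) a (h%:Z - - l) = \sum_(l <- zrange N) a (h%:Z + l).
    by apply: eq_bigr => l _; congr a; lia.
  by congr (_ + a _ - a _); lia.
rewrite -[zseries a](addr0) -[X in _ --> X](subr0).
have [ap an] := a0.
apply: cvgB; first apply: cvgD => //.
  by move: ap; rewrite -(cvg_shiftn h.+1).
rewrite -(cvg_shiftn h).
rewrite (_ : [sequence _]_N = (fun N => a (- N%:Z)))//.
by apply/funext => N; congr a; lia.
Qed.

End abs_summable.

Lemma sum_zrange_annulus (f : int -> R) x y : (x <= y)%N ->
  \sum_(l <- [seq l <- zrange y | (x < `|l|)%N]) f l =
  \sum_(l <- zrange y) f l - \sum_(l <- zrange x) f l.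
Proof.
move=> xy; rewrite big_filter [X in _ = X - _](bigID (fun l : int => (x < `|l|)%N))/=.
suff -> : \sum_(l <- zrange y | ~~ (x < `|l|)%N) f l = \sum_(l <- zrange x) f l by rewrite addrK.
rewrite -big_filter; apply: perm_big; apply: uniq_perm; rewrite ?filter_uniq ?uniq_zrange//.
by move=> l; rewrite mem_filter !mem_zrange; lia.
Qed.

(** Outside the window, [2^r <= |l| <= (1 + |k|) (1 + |k - l|)], whence the constant [D]; the factor
    2 counts the indices [y+1] and [-(y+1)] added at each step. The rate [2^(-2 sigma)] is written
    as [rho / 2] to fit [ae_cvgn_dyadic]. *)
Lemma annulus_coef_bound c (C sigma : R) (k : int) : 1 / 2 < sigma -> 0 <= C ->
  (forall l, `|c l| <= C * wgt l `^ (- sigma)) ->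
  exists2 K, 0 <= K & forall r x y, (2 ^ r <= x)%N -> (x <= y)%N ->
    \sum_(l <- [seq l <- zrange y | (x < `|l|)%N]) c (k - l) ^+ 2 <=
    K * (2 `^ (1 - 2 * sigma) / 2) ^+ r * (y - x)%:R.
Proof.
move=> s0 C0 hc.
pose D := C ^+ 2 * wgt k `^ (2 * sigma).
have D0 : 0 <= D by rewrite mulr_ge0 ?sqr_ge0 ?powR_ge0.
exists (2 * D); first by rewrite mulr_ge0.
move=> r x y rx xy.
have -> : 2 `^ (1 - 2 * sigma) / 2 = 2 `^ (- (2 * sigma)) :> R.
  by rewrite powRD ?pnatr_eq0 ?implybT// powRr1//; field.
set q := 2 `^ (- (2 * sigma)).
have q0 : 0 <= q ^+ r by rewrite exprn_ge0 ?powR_ge0.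
have cq l : (x < `|l|)%N -> c (k - l) ^+ 2 <= D * q ^+ r.
  move=> xl.
  apply: (@le_trans _ _ ((C * wgt (k - l) `^ (- sigma)) ^+ 2)).
    rewrite -real_normK ?num_real//; apply: lerXn2r (hc _); rewrite nnegrE//.
    by rewrite mulr_ge0 ?powR_ge0.
  rewrite exprMn /D -mulrA ler_wpM2l ?sqr_ge0//.
  have w0 : 0 < wgt k :> R by exact: wgt_gt0.
  have w1 : 0 < wgt (k - l) :> R by exact: wgt_gt0.
  have s2 : 0 <= 2 * sigma by lra.
  have e1 : (wgt (k - l) `^ (- sigma)) ^+ 2 = (wgt (k - l) `^ (2 * sigma))^-1 :> R.
    rewrite -powR_mulrn ?powR_ge0// -powRrM mulNr powRN; congr (_ `^ _)^-1; ring.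
  have e2 : q ^+ r = ((2 ^+ r) `^ (2 * sigma))^-1.
    rewrite /q powRN exprVn; congr (_^-1).
    by rewrite -[in RHS]powR_mulrn// -[in LHS]powR_mulrn ?powR_ge0// -!powRrM mulrC.
  rewrite e1 e2.
  rewrite ler_pdivlMr ?powR_gt0 ?exprn_gt0// mulrC ler_pdivrMr ?powR_gt0//.
  rewrite -powRM ?(ltW w0) ?(ltW w1)//.
  apply: (ge0_ler_powR s2); [by rewrite nnegrE exprn_ge0| |].
    by rewrite nnegrE mulr_ge0// ltW.
  rewrite /wgt -natrX -natrM ler_nat.
  apply: (leq_trans rx); apply: (leq_trans (ltnW xl)).
  by clear; nia.
rewrite [leLHS](sum_zrange_annulus (fun l => c (k - l) ^+ 2) xy)/=.
elim: y xy => [|y ih] xy.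
  by move: xy; rewrite leqn0 => /eqP ->; rewrite subrr subnn mulr0.
move: xy; rewrite leq_eqVlt => /predU1P[->|xy]; first by rewrite subrr subnn mulr0.
rewrite sum_zrangeS subSn//.
have xy1 : (x < absz y.+1%:Z)%N by clear - xy; lia.
have h1 := cq y.+1%:Z xy1; have h2 := cq (- y.+1%:Z) (ltac:(by rewrite abszN)).
have h3 := ih xy; rewrite -natr1; lra.
Qed.

End coefficients.

(** * Moments and truncation *)

Section truncation.
Context {R : realType}.

Definition trunc (M x : R) : R := if `|x| <= M then x else 0.

Lemma measurable_trunc M : measurable_fun setT (trunc M).
Proof.
apply: measurable_fun_ifT => //.
by apply: measurable_fun_ler => //; exact: measurableT_comp.
Qed.

(** Where [|x| <= M], write [|x|^2 = |x|^(2-q) |x|^q]. *)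
Lemma trunc_sqr_le (M q x : R) : 0 < M -> 0 < q -> q <= 2 ->
  trunc M x ^+ 2 <= M `^ (2 - q) * `|x| `^ q.
Proof.
move=> M0 q0 q2; rewrite /trunc; case: ifP => [xM|_]; last first.
  by rewrite expr0n/= mulr_ge0 ?powR_ge0.
rewrite -real_normK ?num_real//.
have [->|x0] := eqVneq x 0; first by rewrite normr0 expr0n/= mulr_ge0 ?powR_ge0.
have nx0 : 0 < `|x| by rewrite normr_gt0.
rewrite -powR_mulrn// -[in leLHS](subrK q 2%:R) powRD ?(gt_eqF nx0) ?implybT//.
by rewrite ler_wpM2r ?powR_ge0// ge0_ler_powR ?nnegrE ?subr_ge0// ltW.
Qed.

(** Where [|x| > M], write [|x|^q = |x|^(q-1) |x|] and bound the first factor below by [M^(q-1)]. *)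
Lemma trunc_rest_le (M q x : R) : 0 < M -> 1 <= q ->
  `|x - trunc M x| <= M `^ (1 - q) * `|x| `^ q.
Proof.
move=> M0 q1; rewrite /trunc; case: ifP => [_|/negbT]; first by rewrite subrr normr0 mulr_ge0 ?powR_ge0.
rewrite -ltNge subr0 => Mx.
have nx0 : 0 < `|x| by apply: lt_trans Mx.
have q10 : 0 <= q - 1 by rewrite subr_ge0.
rewrite -(opprB q 1) powRN ler_pdivlMl ?powR_gt0//.
have -> : `|x| `^ q = `|x| `^ (q - 1) * `|x|.
  by rewrite -{3}(powRr1 (ltW nx0)) -powRD ?(gt_eqF nx0) ?implybT// subrK.
by rewrite ler_wpM2r// ge0_ler_powR ?nnegrE// ltW.
Qed.

End truncation.

Section tail_moment.
Context d (T : measurableType d) (R : realType) (P : probability T R).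

(** Dyadic layers: [|X|^q] is at most 1 plus the sum over [j] of [2^(q(j+1))] on the event
    [|X| > 2^j], and the tail bound makes the means geometric with ratio [2^(q - alpha) < 1]. *)
Lemma L1_powR_of_tail (X : T -> R) (alpha q : R) : measurable_fun setT X ->
  (exists C : R, forall t : R, 0 <= t ->
     ((t `^ alpha)%:E * P [set w | (t < `|X w|)%R] <= C%:E)%E) ->
  0 < q -> q < alpha -> L1 P (fun w => `|X w| `^ q).
Proof.
move=> mX [C hC] q0 qa.
have mnX : measurable_fun setT (fun w => `|X w|) by exact: measurableT_comp.
have mXq : measurable_fun setT (fun w => `|X w| `^ q).
  exact: (measurableT_comp (measurable_powR q)).
pose A j := [set w | 2 ^+ j < `|X w|].
have mA j : measurable (A j).
  have := measurable_fun_ltr (measurable_cst (2 ^+ j : R)) mnX.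
  by move=> /(_ measurableT [set true]); rewrite setTI; apply.
pose a j : R := (2 `^ q) ^+ j.+1.
have a0 j : 0 <= a j by rewrite exprn_ge0 ?powR_ge0.
pose F j w := (a j * \1_(A j) w)%:E.
have mF j : measurable_fun setT (F j).
  by apply/measurable_EFinP; apply: measurable_funM.
have F0 j w : (0 <= F j w)%E by rewrite lee_fin mulr_ge0.
have C0 : 0 <= C.
  by rewrite -lee_fin; apply: le_trans (hC 0 (lexx _)); rewrite mule_ge0// lee_fin powR_ge0.
pose rho : R := 2 `^ (q - alpha).
have rho0 : 0 < rho by rewrite powR_gt0.
have rho1 : rho < 1.
  rewrite /rho -opprB powRN invf_lt1 ?powR_gt0//.
  by rewrite /powR pnatr_eq0/= expR_gt1 mulr_gt0 ?subr_gt0 ?ln_gt0// ltr1n.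
have intF j : (\int[P]_w F j w <= (2 `^ q * C * rho ^+ j)%:E)%E.
  rewrite /F; under eq_integral do rewrite EFinM.
  rewrite ge0_integralZl_EFin//; last by apply/measurable_EFinP.
  rewrite integral_indic// setIT.
  have pj : 0 < (2 ^+ j) `^ alpha :> R by rewrite powR_gt0 ?exprn_gt0.
  have := hC (2 ^+ j) (ltac:(by rewrite exprn_ge0)); rewrite -/(A j) => h.
  have fP : P (A j) \is a fin_num by exact: fin_num_measure.
  rewrite -[X in (_ * X <= _)%E](fineK fP) -EFinM lee_fin.
  move: h; rewrite -(fineK fP) -EFinM lee_fin mulrC -ler_pdivlMr// => h.
  apply: (le_trans (ler_wpM2l (a0 j) h)).
  rewrite le_eqVlt; apply/orP; left; apply/eqP.
  have -> : rho ^+ j = (2 `^ q) ^+ j / (2 ^+ j) `^ alpha.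
    rewrite /rho powRB ?pnatr_eq0 ?implybT// expr_div_n; congr (_ / _).
    by rewrite -[in RHS]powR_mulrn// -[in LHS]powR_mulrn ?powR_ge0// -!powRrM mulrC.
  rewrite /a exprS; ring.
apply: L1_ge0 => //.
apply: (@le_lt_trans _ _ (\int[P]_w (1%:E + \sum_(j <oo) F j w))%E).
  apply: ge0_le_integral => //.
  - by apply/measurable_EFinP; exact: mXq.
  - by apply: emeasurable_funD => //; exact: ge0_emeasurable_sum.
  move=> w _.
  have [x1|x1] := leP `|X w| 1.
    apply: (@le_trans _ _ (1%:E + 0)%E); last by rewrite leeD2l// nneseries_ge0.
    rewrite adde0 lee_fin; apply: (@le_trans _ _ (1 `^ q)); last by rewrite powR1.
    by rewrite ge0_ler_powR ?nnegrE// ltW.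
  have ex : exists n, `|X w| <= 2 ^+ n.
    exists (Num.truncn `|X w|).+1.
    apply: ltW; apply: (lt_trans (truncnS_gt _)).
    by rewrite -natrX ltr_nat ltn_expl.
  case: (ex_minnP ex) => -[|j] hj jmin; first by move: x1; rewrite ltNge -(expr0 2) hj.
  have jX : 2 ^+ j < `|X w|.
    by rewrite ltNge; apply/negP => /jmin; rewrite ltnn.
  apply: (@le_trans _ _ (F j w)).
    rewrite lee_fin indicE mem_set// mulr1 /a.
    rewrite -powR_mulrn ?powR_ge0// powRAC powR_mulrn//.
    by rewrite ge0_ler_powR ?nnegrE ?exprn_ge0// ltW.
  apply: (@le_trans _ _ (\sum_(j <oo) F j w)%E); last by rewrite leeDr// lee_fin.
  apply: (le_trans _ (nneseries_lim_ge j.+1 _)) => //.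
  by rewrite big_nat_recr//= leeDr// sume_ge0.
rewrite ge0_integralD//; last 2 first.
- by move=> w _; exact: nneseries_ge0.
- exact: ge0_emeasurable_sum.
rewrite [X in (X + _ < _)%E](_ : _ = 1%:E); last first.
  by rewrite integral_cst// mul1e; exact: probability_setT.
rewrite integral_nneseries//.
apply: lte_add_pinfty; first exact: ltry.
apply: (@le_lt_trans _ _ (\sum_(j <oo) (geometric (2 `^ q * C) rho j)%:E)%E).
  by apply: lee_nneseries => j *; [exact: integral_ge0|exact: intF].
rewrite (_ : (fun n => _) = EFin \o series (geometric (2 `^ q * C) rho)).
  by rewrite EFin_lim ?ltry//; apply: is_cvg_geometric_series; rewrite ger0_norm// ltW.
by apply/funext => n /=; rewrite sumEFin.
Qed.

End tail_moment.

(** * Moments of products of the i.i.d. pairs *)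

Section moments.
Context d (T : measurableType d) (R : realType) (P : probability T R).
Local Notation L1 := (L1 P).
Local Notation Ex := (Ex P).
Variables (X Y : int -> T -> R).
Hypothesis mX : forall l, measurable_fun setT (X l).
Hypothesis mY : forall l, measurable_fun setT (Y l).
Local Notation V := (rvpair X Y).
Hypothesis indV : mutually_independent P V.
Hypothesis idV : identically_distributed P V.

Lemma measurable_rvpair l : measurable_fun setT (V l).
Proof. exact: measurable_fun_pair. Qed.

(** Both sides integrate [g] against the laws of [V l] and [V l'], which agree through the reference
    index 0. *)
Lemma ident_ge0_integral (g : R * R -> R) l l' : measurable_fun setT g -> (forall u, 0 <= g u) ->
  (\int[P]_w (g (V l w))%:E = \int[P]_w (g (V l' w))%:E)%E.
Proof.
move=> mg g0.
have H k : (\int[P]_w (g (V k w))%:E = \int[pushforward P (V k)]_u (g u)%:E)%E.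
  rewrite (ge0_integral_pushforward (measurable_rvpair k) P measurableT)//.
  - by apply/measurable_EFinP; exact: mg.
  - by move=> u _; rewrite lee_fin.
rewrite !H; apply: eq_measure_integral; try exact: measurable_rvpair.
move=> ? ? E mE _.
exact: (etrans (idV l mE) (esym (idV l' mE))).
Qed.

Lemma ident_L1 (g : R * R -> R) l l' : measurable_fun setT g -> L1 (g \o V l') ->
  L1 (g \o V l) /\ Ex (g \o V l) = Ex (g \o V l').
Proof.
move=> mg Ig.
have ge0 (h : R * R -> R) : measurable_fun setT h -> (forall u, 0 <= h u) -> L1 (h \o V l') ->
    L1 (h \o V l) /\ Ex (h \o V l) = Ex (h \o V l').
  move=> mh h0 Ih; have e := ident_ge0_integral l l' mh h0.
  have I : L1 (h \o V l).
    apply: L1_ge0 => [|w|]; [|exact: h0|].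
      by apply: measurableT_comp => //; exact: measurable_rvpair.
    apply: (@le_lt_trans _ _ (Ex (h \o V l'))%:E); last exact: ltry.
    by rewrite -L1_Ex//; rewrite le_eqVlt; apply/orP; left; apply/eqP; exact: e.
  by split=> //; rewrite /Ex /Rintegral; congr fine; exact: e.
have mng : measurable_fun setT (fun u => `|g u|) by exact: measurableT_comp.
have [I1 E1] := ge0 _ mng (fun u => normr_ge0 _) (L1_norm Ig).
have [] := ge0 (fun u => `|g u| + g u).
- exact: measurable_funD.
- by move=> u; rewrite -lerBlDr sub0r -normrN ler_norm.
- by apply: L1D => //; exact: L1_norm.
move=> I2 E2.
have e k : g \o V k = fun w => (`|g (V k w)| + g (V k w)) - `|g (V k w)|.
  by apply/funext => w /=; ring.
rewrite !e; split; first exact: L1B.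
have J1 := L1_norm Ig.
have J2 : L1 (fun w => `|g (V l' w)| + g (V l' w)) by exact: L1D.
rewrite (ExB I2 I1) (ExB J2 J1).
by congr (_ - _).
Qed.

Lemma indep_pair (g h : R * R -> R) l m : l != m ->
  measurable_fun setT g -> measurable_fun setT h -> L1 (g \o V l) -> L1 (h \o V m) ->
  L1 (fun w => g (V l w) * h (V m w)) /\
  Ex (fun w => g (V l w) * h (V m w)) = Ex (g \o V l) * Ex (h \o V m).
Proof.
move=> lm mg mh Ig Ih.
pose f i := if i == l then g else h.
have fl : f l = g by rewrite /f eqxx.
have fm : f m = h by rewrite /f eq_sym (negbTE lm).
have [] := @indep_prod _ _ _ P V measurable_rvpair indV [:: l; m] f.
- by rewrite /= inE lm.
- by move=> i; rewrite /f; case: ifP.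
- by move=> i; rewrite !inE => /orP[|] /eqP ->; rewrite ?fl ?fm.
rewrite !big_cons big_nil fl fm mulr1.
by under eq_fun do rewrite !big_cons big_nil mulr1 fl fm.
Qed.

Hypothesis EX0 : forall l, Ex (X l) = 0.
Hypothesis EY0 : forall l, Ex (Y l) = 0.
Hypothesis IX2 : forall l, L1 (fun w => X l w ^+ 2).
Hypothesis IY2 : forall l, L1 (fun w => Y l w ^+ 2).

Lemma L1_of_sqr (Z : T -> R) : measurable_fun setT Z -> L1 (fun w => Z w ^+ 2) -> L1 Z.
Proof.
move=> mZ IZ.
have m1 : measurable_fun setT (fun _ : T => 1 : R) by exact: measurable_cst.
have := L1_mul mZ m1 IZ (L1_cst P (1 ^+ 2)).
by under eq_fun do rewrite mulr1.
Qed.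

Lemma L1_monomial l (a b : nat) : (a + b <= 2)%N -> L1 (fun w => X l w ^+ a * Y l w ^+ b).
Proof.
have IX := L1_of_sqr (mX l) (IX2 l); have IY := L1_of_sqr (mY l) (IY2 l).
case: a => [|[|[|a]]]; case: b => [|[|[|b]]] //= _.
- by under eq_fun do rewrite !expr0 mulr1; exact: L1_cst.
- by under eq_fun do rewrite expr0 mul1r expr1.
- by under eq_fun do rewrite expr0 mul1r.
- by under eq_fun do rewrite expr0 mulr1 expr1.
- by under eq_fun do rewrite !expr1; exact: L1_mul.
- by under eq_fun do rewrite expr0 mulr1.
Qed.

Lemma prod_delta (J : seq int) (x : int -> R) l : uniq J -> l \in J ->
  \prod_(i <- J) x i ^+ (i == l) = x l.
Proof.
move=> uJ lJ; rewrite (bigD1_seq l)//= eqxx expr1 big1 ?mulr1// => i /negbTE ->.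
by rewrite expr0.
Qed.

(* Some index occurs in exactly one of the four factors, and the corresponding
   factor of the expectation is E[X] or E[Y]. *)
Lemma Ex_cross l m l' m' : l != m -> l' != m' -> (l, m) != (l', m') -> (l, m) != (m', l') ->
  Ex (fun w => (X l w * Y m w) * (X l' w * Y m' w)) = 0.
Proof.
move=> lm lm' ne1 ne2.
pose J := undup [:: l; m; l'; m'].
pose a i : nat := ((i == l) + (i == l'))%N; pose b i : nat := ((i == m) + (i == m'))%N.
pose f i (u : R * R) := u.1 ^+ a i * u.2 ^+ b i.
have uJ : uniq J by exact: undup_uniq.
have inJ i : (i \in J) = [|| i == l, i == m, i == l' | i == m'].
  by rewrite mem_undup !inE.
have mf i : measurable_fun setT (f i).
  by apply: measurable_funM; apply: measurable_funX.
have If i : i \in J -> L1 (f i \o V i).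
  move=> _; apply: L1_monomial; rewrite /a /b.
  (* As [l <> m], each of the two products involves the index [i] at most once, so the total degree
     in the pair at [i] is at most 2: second moments suffice. *)
  have : ((i == l) + (i == m) <= 1)%N.
    by case: (i =P l) => [->|_]; [rewrite (negbTE lm)|case: (i == m)].
  have : ((i == l') + (i == m') <= 1)%N.
    by case: (i =P l') => [->|_]; [rewrite (negbTE lm')|case: (i == m')].
  lia.
have [_ E] := indep_prod measurable_rvpair indV uJ mf If.
have -> : (fun w => (X l w * Y m w) * (X l' w * Y m' w)) =
    (fun w => \prod_(i <- J) f i (V i w)).
  apply/funext => w; rewrite /f.
  under eq_bigr do rewrite /a /b !exprD.
  rewrite !big_split/= (prod_delta (X^~ w))// ?(prod_delta (X^~ w))//
    ?(prod_delta (Y^~ w))// ?(prod_delta (Y^~ w))// ?inJ ?eqxx ?orbT//; ring.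
rewrite E.
suff [i iJ Ei] : exists2 i, i \in J & Ex (f i \o V i) = 0.
  by rewrite (bigD1_seq i)//= Ei mul0r.
have fX i : a i = 1%N -> b i = 0%N -> Ex (f i \o V i) = 0.
  move=> ai bi; rewrite -(EX0 i); congr Ex; apply/funext => w.
  by rewrite /f /= ai bi expr0 expr1 mulr1.
have fY i : a i = 0%N -> b i = 1%N -> Ex (f i \o V i) = 0.
  move=> ai bi; rewrite -(EY0 i); congr Ex; apply/funext => w.
  by rewrite /f /= ai bi expr0 expr1 mul1r.
have [ll'|ll'] := eqVneq l l'.
  have mm' : m != m' by apply: contraNneq ne1 => mm; rewrite ll' mm.
  exists m; first by rewrite inJ eqxx orbT.
  apply: fY; first by rewrite /a -ll' eq_sym (negbTE lm).
  by rewrite /b eqxx (negbTE mm').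
have [lm1|lm1] := eqVneq l m'.
  have ml' : m != l' by apply: contraNneq ne2 => mm; rewrite lm1 mm.
  exists m; first by rewrite inJ eqxx orbT.
  apply: fY; first by rewrite /a [m == l]eq_sym (negbTE lm) (negbTE ml').
  by rewrite /b eqxx -lm1 [m == l]eq_sym (negbTE lm).
exists l; first by rewrite inJ eqxx.
apply: fX; first by rewrite /a eqxx (negbTE ll').
by rewrite /b (negbTE lm) (negbTE lm1).
Qed.

Lemma Ex_sqr_pair l m : l != m ->
  L1 (fun w => (X l w * Y m w) ^+ 2) /\
  Ex (fun w => (X l w * Y m w) ^+ 2) = Ex (fun w => X l w ^+ 2) * Ex (fun w => Y m w ^+ 2).
Proof.
move=> lm.
have [] := @indep_pair (fun u => u.1 ^+ 2) (fun u => u.2 ^+ 2) l m lm.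
- by apply: measurable_funX.
- by apply: measurable_funX.
- exact: IX2.
- exact: IY2.
by under eq_fun do rewrite -exprMn.
Qed.

End moments.

(** * The strong law *)

Lemma sumr_natB (V : zmodType) (F : nat -> V) x y : (x <= y)%N ->
  \sum_(0 <= k < y) F k - \sum_(0 <= k < x) F k = \sum_(x <= k < y) F k.
Proof. by move=> xy; rewrite (@big_cat_nat _ _ _ x)//= addrAC subrr add0r. Qed.

(** * Increments of the off-diagonal and diagonal parts *)

Section blocks.
Context d (T : measurableType d) (R : realType) (P : probability T R).
Local Notation L1 := (L1 P).
Local Notation Ex := (Ex P).
Variables (X Y : int -> T -> R).
Hypothesis mX : forall l, measurable_fun setT (X l).
Hypothesis mY : forall l, measurable_fun setT (Y l).
Local Notation V := (rvpair X Y).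
Hypothesis indV : mutually_independent P V.
Hypothesis idV : identically_distributed P V.
Hypothesis EX0 : forall l, Ex (X l) = 0.
Hypothesis EY0 : forall l, Ex (Y l) = 0.
Hypothesis IX2 : forall l, L1 (fun w => X l w ^+ 2).
Hypothesis IY2 : forall l, L1 (fun w => Y l w ^+ 2).
Variables (s2 sb2 : R).
Hypothesis EX2 : forall l, Ex (fun w => X l w ^+ 2) = s2.
Hypothesis EY2 : forall l, Ex (fun w => Y l w ^+ 2) = sb2.
Variables c cb : int -> R.
Local Notation a := (fun l => c l * cb l).

(** Masking by 0 outside [e] gives a family that is orthogonal over all pairs, so sums need not be
    restricted. *)
Definition prodXY (e : rel int) (p : int * int) (w : T) : R :=
  if e p.1 p.2 then X p.1 w * Y p.2 w else 0.

(** Evaluated at time [k+1], so that sums over [0 <= k < n] run over the times 1 to [n]. *)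
Definition offdiag (e : rel int) (N k : nat) (w : T) : R :=
  \sum_(l <- zrange N) \sum_(m <- zrange N)
    c (k.+1%:Z - l) * cb (k.+1%:Z - m) * prodXY e (l, m) w.

Lemma s2_ge0 : 0 <= s2.
Proof. by rewrite -(EX2 0); apply: Ex_ge0 => w; exact: sqr_ge0. Qed.

Lemma sb2_ge0 : 0 <= sb2.
Proof. by rewrite -(EY2 0); apply: Ex_ge0 => w; exact: sqr_ge0. Qed.

(** Asymmetry of [e] excludes the one pairing, [(l, m)] with [(m, l)], that would break
    orthogonality; the variance is then the sum of squared coefficients. *)
Lemma offdiag_block (e : rel int) (D : R) N x y :
  (forall l m, e l m -> l != m) -> (forall l m, e l m -> ~~ e m l) ->
  \sum_(l <- zrange N) \sum_(m <- zrange N)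
    (\sum_(x <= k < y) c (k.+1%:Z - l) * cb (k.+1%:Z - m)) ^+ 2 <= D ->
  L1 (fun w => (\sum_(x <= k < y) offdiag e N k w) ^+ 2) /\
  Ex (fun w => (\sum_(x <= k < y) offdiag e N k w) ^+ 2) <= s2 * sb2 * D.
Proof.
move=> e_irr e_asym hD.
pose s := [seq (l, m) | l <- zrange N, m <- zrange N].
pose A (p : int * int) := \sum_(x <= k < y) c (k.+1%:Z - p.1) * cb (k.+1%:Z - p.2).
have us : uniq s.
  by apply: allpairs_uniq; rewrite ?uniq_zrange// => -[? ?] [? ?].
have s0 := s2_ge0; have sb0 := sb2_ge0.
have mZ p : measurable_fun setT (prodXY e p).
  rewrite /prodXY; case: (e _ _); [exact: measurable_funM|exact: measurable_cst].
have ZE p : prodXY e p = if e p.1 p.2 then (fun w => X p.1 w * Y p.2 w) else (fun=> 0).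
  by apply/funext => w; rewrite /prodXY; case: ifP.
have sq p := @Ex_sqr_pair _ _ _ P X Y mX mY indV IX2 IY2 p.1 p.2.
have IZ p : L1 (fun w => prodXY e p w ^+ 2).
  rewrite ZE; case: ifPn => [he|_]; last exact: L1_cst.
  by have [] := sq p (e_irr _ _ he).
have oZ p p' : p != p' -> Ex (fun w => prodXY e p w * prodXY e p' w) = 0.
  case: p p' => [l m] [l' m'] pp'; rewrite !ZE/=.
  case: ifPn => elm; last by under eq_fun do rewrite mul0r; exact: Ex_cst.
  case: ifPn => elm'; last by under eq_fun do rewrite mulr0; exact: Ex_cst.
  apply: (Ex_cross mX mY indV EX0 EY0 IX2 IY2 (e_irr _ _ elm) (e_irr _ _ elm') pp').
  by apply: contraTneq elm => -[-> ->]; exact: e_asym.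
have EZ p : Ex (fun w => prodXY e p w ^+ 2) <= s2 * sb2.
  rewrite ZE; case: ifPn => [he|_].
    by have [_ ->] := sq p (e_irr _ _ he); rewrite EX2 EY2.
  by rewrite Ex_cst expr0n/= mulr_ge0.
have [I E] := Ex_orthogonal_sum A us mZ IZ oZ EZ.
have eqS : (fun w => (\sum_(x <= k < y) offdiag e N k w) ^+ 2) =
    (fun w => (\sum_(i <- s) A i * prodXY e i w) ^+ 2).
  apply/funext => w; congr (_ ^+ 2).
  rewrite big_allpairs /offdiag exchange_big/=; apply: eq_bigr => l _.
  rewrite exchange_big/=; apply: eq_bigr => m _.
  by rewrite /A mulr_suml.
rewrite eqS; split=> //; apply: (le_trans E).
rewrite ler_wpM2l ?mulr_ge0//.
by rewrite big_allpairs.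
Qed.

Lemma offdiag_split N (k : nat) w :
  \sum_(l <- zrange N) \sum_(m <- zrange N)
     c (k.+1%:Z - l) * cb (k.+1%:Z - m) * X l w * Y m w =
  offdiag (fun l m => l < m) N k w + offdiag (fun l m => m < l) N k w +
  \sum_(l <- zrange N) a (k.+1%:Z - l) * (X l w * Y l w).
Proof.
rewrite /offdiag -!big_split/= big_seq [RHS]big_seq; apply: eq_bigr => l lN.
rewrite -big_split/= [X in _ = _ + X](_ : _ = \sum_(m <- zrange N) if m == l then
    c (k.+1%:Z - l) * cb (k.+1%:Z - m) * (X l w * Y m w) else 0); last first.
  by rewrite -big_mkcond/= -big_filter filter_pred1_uniq ?uniq_zrange// big_seq1.
rewrite -big_split/=; apply: eq_bigr => m _; rewrite /prodXY/=.
by case: ltgtP => [||->]; rewrite ?mulr0 ?addr0 ?add0r mulrA.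
Qed.

Section diagonal.
Variables (A q mu : R).
Hypothesis A0 : 0 <= A.
Hypothesis aA : forall s : seq int, uniq s -> \sum_(l <- s) `|a l| <= A.
Hypothesis q1 : 1 < q.
Hypothesis q2 : q < 2.
Local Notation eta l := (fun w => X l w * Y l w).
Hypothesis Iq : L1 (fun w => `|X 1 w * Y 1 w| `^ q).
Hypothesis Emu : Ex (fun w => `|X 1 w * Y 1 w| `^ q) = mu.

Definition diag_part (M : R) (N k : nat) (w : T) : R :=
  \sum_(l <- zrange N) a (k.+1%:Z - l) *
    (trunc M (X l w * Y l w) - Ex (fun w => trunc M (X 1 w * Y 1 w))).

(** Absolute values stand inside both sums, so this is nondecreasing in [n]: its value at [2^r]
    controls the truncation error at every [n <= 2^r], with no maximal inequality. *)
Definition diag_tail (M : R) (N n : nat) (w : T) : R :=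
  \sum_(0 <= k < n) \sum_(l <- zrange N) `|a (k.+1%:Z - l)| *
    (`|X l w * Y l w - trunc M (X l w * Y l w)| +
     Ex (fun w => `|X 1 w * Y 1 w - trunc M (X 1 w * Y 1 w)|)).

Let meta : measurable_fun setT (fun u : R * R => u.1 * u.2).
Proof. exact: measurable_funM. Qed.

Let mtr M : measurable_fun setT (fun u : R * R => trunc M (u.1 * u.2)).
Proof. by apply: (measurableT_comp (measurable_trunc M)); exact: meta. Qed.

Let mrest M : measurable_fun setT (fun u : R * R => `|u.1 * u.2 - trunc M (u.1 * u.2)|).
Proof. by apply: measurableT_comp => //; apply: measurable_funB => //; exact: meta. Qed.

Let mV := measurable_rvpair mX mY.

Lemma mu_ge0 : 0 <= mu.
Proof. by rewrite -Emu; apply: Ex_ge0 => w; exact: powR_ge0. Qed.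

Lemma L1_eta l : L1 (eta l).
Proof. exact: L1_mul. Qed.

Lemma L1_trunc_sqr M l : 0 < M ->
  L1 (fun w => trunc M (X l w * Y l w) ^+ 2) /\
  Ex (fun w => trunc M (X l w * Y l w) ^+ 2) <= M `^ (2 - q) * mu.
Proof.
move=> M0.
have I1 : L1 ((fun u : R * R => trunc M (u.1 * u.2) ^+ 2) \o V 1).
  apply: (L1_le (g := fun w => M `^ (2 - q) * `|X 1 w * Y 1 w| `^ q)).
  - by apply: measurableT_comp => //; apply: measurable_funX; exact: mtr.
  - move=> w; rewrite ger0_norm ?sqr_ge0//; apply: trunc_sqr_le M0 _ (ltW q2); exact: lt_trans ltr01 q1.
  - exact: L1Z.
have [] := ident_L1 mX mY idV l (measurable_funX 2 (mtr M)) I1.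
move=> I E; split=> //; rewrite [leLHS]E -Emu -ExZ//.
apply: Ex_le => //; first exact: L1Z.
move=> w; apply: trunc_sqr_le M0 _ (ltW q2); exact: lt_trans ltr01 q1.
Qed.

Lemma L1_trunc M l : 0 < M -> L1 (fun w => trunc M (X l w * Y l w)) /\
  Ex (fun w => trunc M (X l w * Y l w)) = Ex (fun w => trunc M (X 1 w * Y 1 w)).
Proof.
move=> M0.
have I k : L1 (fun w => trunc M (X k w * Y k w)).
  apply: L1_of_sqr; last by have [] := L1_trunc_sqr k M0.
  exact: (measurableT_comp (mtr M) (mV k)).
by have [] := ident_L1 mX mY idV l (mtr M) (I 1).
Qed.

(** The centred truncated products are independent with variance at most [M^(2-q) mu], and the block
    coefficients have squared sum at most [A^2 (y - x)]. *)
Lemma diag_part_block (M : R) N x y : 0 < M -> (x <= y)%N ->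
  L1 (fun w => (\sum_(x <= k < y) diag_part M N k w) ^+ 2) /\
  Ex (fun w => (\sum_(x <= k < y) diag_part M N k w) ^+ 2) <=
    M `^ (2 - q) * mu * (A ^+ 2 * (y - x)%:R).
Proof.
move=> M0 xy.
pose t := Ex (fun w => trunc M (X 1 w * Y 1 w)).
pose g (u : R * R) := trunc M (u.1 * u.2) - t.
have mg : measurable_fun setT g by exact: measurable_funB.
pose Z l w := g (V l w).
have mZ l : measurable_fun setT (Z l) by exact: (measurableT_comp mg (mV l)).
have IZ1 l : L1 (Z l) by apply: L1B; [have [] := L1_trunc l M0|exact: L1_cst].
have EZ0 l : Ex (Z l) = 0.
  by have [I E] := L1_trunc l M0; rewrite ExB ?E ?Ex_cst ?subrr//; exact: L1_cst.
(* The form of [variance = second moment - t^2] in which the linear term is a multiple of the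
   mean-zero variable [Z l]. *)
have sqE l : (fun w => Z l w ^+ 2) =
    fun w => trunc M (X l w * Y l w) ^+ 2 - (2 * t * Z l w + t ^+ 2).
  by apply/funext => w; rewrite /Z /g /=; ring.
have IL l : L1 (fun w => 2 * t * Z l w + t ^+ 2).
  by apply: L1D; [exact: L1Z|exact: L1_cst].
have IZ l : L1 (fun w => Z l w ^+ 2).
  by rewrite sqE; apply: L1B => //; have [] := L1_trunc_sqr l M0.
have EZ l : Ex (fun w => Z l w ^+ 2) <= M `^ (2 - q) * mu.
  have [I E] := L1_trunc_sqr l M0.
  rewrite sqE ExB// (ExD (L1Z (2 * t) (IZ1 l)) (L1_cst P _)) ExZ// EZ0 Ex_cst.
  by rewrite mulr0 add0r; apply: le_trans E; rewrite gerBl sqr_ge0.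
have oZ l m : l != m -> Ex (fun w => Z l w * Z m w) = 0.
  move=> lm; have [_ ->] := indep_pair mX mY indV lm mg mg (IZ1 l) (IZ1 m).
  by rewrite [X in X * _](EZ0 l) mul0r.
have [I E] := Ex_orthogonal_sum (fun l => \sum_(x <= k < y) a (k.+1%:Z - l))
  (uniq_zrange N) mZ IZ oZ EZ.
have eqS : (fun w => (\sum_(x <= k < y) diag_part M N k w) ^+ 2) =
    (fun w => (\sum_(l <- zrange N) (\sum_(x <= k < y) a (k.+1%:Z - l)) * Z l w) ^+ 2).
  apply/funext => w; congr (_ ^+ 2); rewrite exchange_big/=; apply: eq_bigr => l _.
  by rewrite mulr_suml.
rewrite eqS; split=> //; apply: (le_trans E).
rewrite ler_wpM2l ?mulr_ge0 ?powR_ge0 ?mu_ge0//.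
exact: (abs_summable_block_sqr A0 aA (uniq_zrange N) xy).
Qed.

Lemma L1_rest M l : 0 < M ->
  L1 (fun w => `|X l w * Y l w - trunc M (X l w * Y l w)|) /\
  Ex (fun w => `|X l w * Y l w - trunc M (X l w * Y l w)|) =
  Ex (fun w => `|X 1 w * Y 1 w - trunc M (X 1 w * Y 1 w)|).
Proof.
move=> M0.
have I k : L1 (fun w => `|X k w * Y k w - trunc M (X k w * Y k w)|).
  by apply: L1_norm; apply: L1B; [exact: L1_eta|have [] := L1_trunc k M0].
by have [] := ident_L1 mX mY idV l (mrest M) (I 1).
Qed.

Lemma Ex_rest_le M : 0 < M ->
  Ex (fun w => `|X 1 w * Y 1 w - trunc M (X 1 w * Y 1 w)|) <= M `^ (1 - q) * mu.
Proof.
move=> M0; rewrite -Emu -ExZ//; apply: Ex_le; first by have [] := L1_rest 1 M0.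
  exact: L1Z.
by move=> w; apply: trunc_rest_le => //; exact: ltW.
Qed.

Lemma diag_tail_ge0 M N n w : 0 <= diag_tail M N n w.
Proof.
rewrite sumr_ge0// => k _; rewrite sumr_ge0// => l _.
by rewrite mulr_ge0// addr_ge0// Ex_ge0.
Qed.

Lemma Ex_diag_tail M N n : 0 < M ->
  L1 (diag_tail M N n) /\
  Ex (diag_tail M N n) <= A * n%:R * (2 * (M `^ (1 - q) * mu)).
Proof.
move=> M0.
have IR l := L1_rest l M0.
set h := Ex (fun w => `|X 1 w * Y 1 w - trunc M (X 1 w * Y 1 w)|) in IR *.
have I1 l : L1 (fun w => `|X l w * Y l w - trunc M (X l w * Y l w)| + h).
  by apply: L1D; [have [] := IR l|exact: L1_cst].
have I2 (k : nat) l : L1 (fun w => `|a (k.+1%:Z - l)| *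
   (`|X l w * Y l w - trunc M (X l w * Y l w)| + h)) by exact: L1Z.
have I3 (k : nat) : L1 (fun w => \sum_(l <- zrange N) `|a (k.+1%:Z - l)| *
   (`|X l w * Y l w - trunc M (X l w * Y l w)| + h)) by exact: L1_sum.
split; first exact: L1_sum.
rewrite Ex_sum//.
have h0 : 0 <= h by exact: Ex_ge0.
apply: (@le_trans _ _ (\sum_(0 <= k < n) A * (2 * h))).
  apply: ler_sum => k _; rewrite Ex_sum//.
  apply: (@le_trans _ _ (\sum_(l <- zrange N) `|a (k.+1%:Z - l)| * (2 * h))).
    apply: ler_sum => l _; rewrite ExZ//; have [Il El] := IR l.
    by rewrite ExD// ?Ex_cst ?El; [rewrite mulr_natl mulr2n|exact: L1_cst].
  rewrite -mulr_suml ler_wpM2r ?mulr_ge0//.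
  exact: (@abs_summable_row R (fun l => c l * cb l) A A0 aA k.+1%:Z (zrange N) (uniq_zrange N)).
rewrite sumr_const_nat subn0 -[(A * _) *+ n]mulr_natr mulrAC ler_wpM2l ?mulr_ge0// ler_pM2l//.
exact: Ex_rest_le.
Qed.

Lemma diag_tail_bound M N r n w : 0 < M -> (n <= 2 ^ r)%N ->
  `|\sum_(0 <= k < n) (\sum_(l <- zrange N) a (k.+1%:Z - l) * (X l w * Y l w) -
      Ex (eta 1) * (\sum_(l <- zrange N) a (k.+1%:Z - l)) - diag_part M N k w)|
  <= diag_tail M N (2 ^ r) w.
Proof.
move=> M0 nr.
apply: (le_trans (ler_norm_sum _ _ _)).
rewrite /diag_tail [leRHS](@big_cat_nat _ _ _ n)//=.
apply: ler_wpDr.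
  rewrite sumr_ge0// => k _; rewrite sumr_ge0// => l _.
  by rewrite mulr_ge0// addr_ge0// Ex_ge0.
apply: ler_sum => k _.
have -> : \sum_(l <- zrange N) a (k.+1%:Z - l) * (X l w * Y l w) -
      Ex (eta 1) * (\sum_(l <- zrange N) a (k.+1%:Z - l)) - diag_part M N k w =
  \sum_(l <- zrange N) a (k.+1%:Z - l) * ((X l w * Y l w - trunc M (X l w * Y l w)) -
     Ex (fun w => X 1 w * Y 1 w - trunc M (X 1 w * Y 1 w))).
  rewrite ExB; [|exact: L1_eta|by have [] := L1_trunc 1 M0].
  rewrite mulr_sumr /diag_part -!sumrB; apply: eq_bigr => l _; ring.
apply: (le_trans (ler_norm_sum _ _ _)).
apply: ler_sum => l _; rewrite normrM ler_wpM2l//.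
apply: (le_trans (ler_normB _ _)); rewrite lerD2l.
apply: le_normr_Rintegral => //.
by apply: L1B; [exact: L1_eta|have [] := L1_trunc 1 M0].
Qed.

End diagonal.

End blocks.

Section linear_convergence.
Context d (T : measurableType d) (R : realType) (P : probability T R).

(** Increments from window [x] to window [y] are orthogonal sums over an annulus; their block decay
    is [rho = 2^(1 - 2 sigma)], and [rho < 1] because [sigma > 1/2]. *)
Lemma ae_cvgn_linear (Z : int -> T -> R) (c : int -> R) (C sigma K : R) (k : int) :
  1 / 2 < sigma -> 0 <= C -> (forall l, `|c l| <= C * wgt l `^ (- sigma)) ->
  (forall l, measurable_fun setT (Z l)) -> (forall l, L1 P (fun w => Z l w ^+ 2)) ->
  (forall l m, l != m -> Ex P (fun w => Z l w * Z m w) = 0) ->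
  0 <= K -> (forall l, Ex P (fun w => Z l w ^+ 2) <= K) ->
  {ae P, forall w, cvgn (fun N => \sum_(l <- zrange N) c (k - l) * Z l w)}.
Proof.
move=> s0 C0 hc mZ IZ oZ K0 EZ.
have [D D0 hD] := annulus_coef_bound k s0 C0 hc.
apply: (@ae_cvgn_dyadic _ _ _ P (fun N w => \sum_(l <- zrange N) c (k - l) * Z l w)
  (K * D) (2 `^ (1 - 2 * sigma))).
- exact: mulr_ge0.
- rewrite powR_gt0//= -opprB powRN invf_lt1 ?powR_gt0//.
  by rewrite /powR pnatr_eq0/= expR_gt1 mulr_gt0 ?ln_gt0 ?ltr1n//; lra.
move=> r x y rx xy _.
have uA : uniq [seq l <- zrange y | (x < `|l|)%N] by rewrite filter_uniq// uniq_zrange.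
have [I E] := Ex_orthogonal_sum (fun l => c (k - l)) uA mZ IZ oZ EZ.
have eqS : (fun w => (\sum_(l <- zrange y) c (k - l) * Z l w -
     \sum_(l <- zrange x) c (k - l) * Z l w) ^+ 2) =
    fun w => (\sum_(l <- [seq l <- zrange y | (x < `|l|)%N]) c (k - l) * Z l w) ^+ 2.
  by apply/funext => w; rewrite -(sum_zrange_annulus (fun l => c (k - l) * Z l w) xy).
rewrite eqS; split=> //; apply: (le_trans E).
by rewrite -!mulrA ler_wpM2l// mulrA hD.
Qed.

End linear_convergence.

Lemma powR2_expr_split (R : realType) (x y : R) r :
  (2 `^ (x + y)) ^+ r = (2 `^ x) ^+ r * (2 `^ y) ^+ r.
Proof. by rewrite powRD ?pnatr_eq0 ?implybT// exprMn. Qed.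

Lemma powR2_lt1 (R : realType) (x : R) : x < 0 -> 0 < 2 `^ x < 1.
Proof.
move=> x0; rewrite powR_gt0//= -[x]opprK powRN invf_lt1 ?powR_gt0//.
by rewrite /powR pnatr_eq0/= expR_gt1 mulr_gt0 ?oppr_gt0// ln_gt0// ltr1n.
Qed.

Lemma sqr_sum3_le (R : realType) (x y z : R) :
  (x + y + z) ^+ 2 <= 3 * (x ^+ 2 + y ^+ 2 + z ^+ 2).
Proof.
rewrite -subr_ge0 (_ : _ - _ = (x - y) ^+ 2 + (y - z) ^+ 2 + (x - z) ^+ 2); last by ring.
by rewrite !addr_ge0 ?sqr_ge0.
Qed.

(** * Choice of exponents and assembly *)

Section strong_law.
Context d (T : measurableType d) (R : realType) (P : probability T R).
Local Notation L1 := (L1 P).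
Local Notation Ex := (Ex P).
Variables (X Y : int -> T -> R).
Hypothesis mX : forall l, measurable_fun setT (X l).
Hypothesis mY : forall l, measurable_fun setT (Y l).
Local Notation V := (rvpair X Y).
Hypothesis indV : mutually_independent P V.
Hypothesis idV : identically_distributed P V.
Hypothesis EX0 : forall l, Ex (X l) = 0.
Hypothesis EY0 : forall l, Ex (Y l) = 0.
Hypothesis IX1 : L1 (fun w => X 1 w ^+ 2).
Hypothesis IY1 : L1 (fun w => Y 1 w ^+ 2).
Variables (c cb : int -> R) (C Cb alpha sigma sigmab p : R).
Hypothesis tail : exists D : R, forall t : R, 0 <= t ->
  ((t `^ alpha)%:E * P [set w | (t < `|X 1 w * Y 1 w|)%R] <= D%:E)%E.
Hypothesis sigma12 : 1 / 2 < sigma <= 1.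
Hypothesis sigmab12 : 1 / 2 < sigmab <= 1.
Hypothesis C0 : 0 <= C.
Hypothesis Cb0 : 0 <= Cb.
Hypothesis cC : forall l, `|c l| <= C * wgt l `^ (- sigma).
Hypothesis cbC : forall l, `|cb l| <= Cb * wgt l `^ (- sigmab).
Hypothesis alpha1 : 1 < alpha.
Hypothesis p0 : 0 < p.
Hypothesis p_sigma : p * (2 - sigma - sigmab) < 1.
Hypothesis p_alpha : p < alpha.
Hypothesis p2 : p < 2.
Local Notation a := (fun l => c l * cb l).

Let X2 l : L1 (fun w => X l w ^+ 2) /\ Ex (fun w => X l w ^+ 2) = Ex (fun w => X 1 w ^+ 2).
Proof.
have mf : measurable_fun setT (fun u : R * R => u.1 ^+ 2) by exact: measurable_funX.
exact: (ident_L1 mX mY idV l mf IX1).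
Qed.

Let Y2 l : L1 (fun w => Y l w ^+ 2) /\ Ex (fun w => Y l w ^+ 2) = Ex (fun w => Y 1 w ^+ 2).
Proof.
have mf : measurable_fun setT (fun u : R * R => u.2 ^+ 2) by exact: measurable_funX.
exact: (ident_L1 mX mY idV l mf IY1).
Qed.

Let IX2 l := (X2 l).1.
Let IY2 l := (Y2 l).1.
Let EX2 l := (X2 l).2.
Let EY2 l := (Y2 l).2.

(** Over a square window the double sum is the product of two linear sums, each almost surely
    convergent. Hence the [limn] in [dk] is a genuine limit, simultaneously for the countably many
    [k]. *)
Lemma ae_cvg_dk : {ae P, forall w (k : nat),
  \sum_(l <- zrange N) \sum_(m <- zrange N) c (k%:Z - l) * cb (k%:Z - m) * X l w * Y m w
    @[N --> \oo] --> dk c cb X Y k%:Z w}.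
Proof.
have s0 : 1 / 2 < sigma by case/andP: sigma12.
have sb0 : 1 / 2 < sigmab by case/andP: sigmab12.
have mV := measurable_rvpair mX mY.
have oX l m : l != m -> Ex (fun w => X l w * X m w) = 0.
  move=> lm; have [_ ->] := indep_pair mX mY indV lm measurable_fst measurable_fst
    (L1_of_sqr (mX l) (IX2 l)) (L1_of_sqr (mX m) (IX2 m)).
  by rewrite [X in X * _](EX0 l) mul0r.
have oY l m : l != m -> Ex (fun w => Y l w * Y m w) = 0.
  move=> lm; have [_ ->] := indep_pair mX mY indV lm measurable_snd measurable_snd
    (L1_of_sqr (mY l) (IY2 l)) (L1_of_sqr (mY m) (IY2 m)).
  by rewrite [X in X * _](EY0 l) mul0r.
apply: ae_foralln => k.
have cvX := ae_cvgn_linear k%:Z s0 C0 cC mX IX2 oX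
  (s2_ge0 (fun l => EX2 l)) (fun l => ltac:(by rewrite EX2)).
have cvY := ae_cvgn_linear k%:Z sb0 Cb0 cbC mY IY2 oY
  (s2_ge0 (fun l => EY2 l)) (fun l => ltac:(by rewrite EY2)).
move: cvY; apply: filterS2 cvX => w hX hY.
rewrite /dk; apply: (@cvgP _ _).
rewrite (_ : (fun N => _) = (fun N => (\sum_(l <- zrange N) c (k%:Z - l) * X l w) *
   (\sum_(m <- zrange N) cb (k%:Z - m) * Y m w))); last first.
  apply/funext => N; rewrite big_distrlr/=; apply: eq_bigr => l _; apply: eq_bigr => m _; ring.
exact: is_cvgM.
Qed.

Lemma ae_strong_law : {ae P, forall w,
  (\sum_(0 <= k < n) (dk c cb X Y k.+1%:Z w - Ex (fun w => X 1 w * Y 1 w) * zseries a))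
    / n%:R `^ p^-1 @[n --> \oo] --> (0 : R)}.
Proof.
have /andP[s0 s1] := sigma12; have /andP[sb0 sb1] := sigmab12.
set e1 := Ex (fun w => X 1 w * Y 1 w).
have pV0 : 0 < p^-1 by rewrite invr_gt0.
have ps : 2 - sigma - sigmab < p^-1.
  by rewrite -(ltr_pM2l p0) mulfV ?(gt_eqF p0).
have pV2 : 1 / 2 < p^-1 by rewrite div1r ltf_pV2 ?posrE.
(* Midpoint of the interval of admissible exponents: the lower end serves [block_coef_bound], the
   upper end makes [kappa + 1 < 2/p]. The interval is nonempty since [p < 2] and
   [p (2 - sigma - sigmab) < 1]. *)
pose kappa := (Num.max 0 (3 - 2 * sigma - 2 * sigmab) + (2 * p^-1 - 1)) / 2.
have m1 : Num.max 0 (3 - 2 * sigma - 2 * sigmab) < 2 * p^-1 - 1.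
  by rewrite gt_max; apply/andP; split; lra.
have m2 : 0 <= Num.max 0 (3 - 2 * sigma - 2 * sigmab) by rewrite le_max lexx.
have m3 : 3 - 2 * sigma - 2 * sigmab <= Num.max 0 (3 - 2 * sigma - 2 * sigmab).
  by rewrite le_max lexx orbT.
have k0 : 0 <= kappa by rewrite /kappa; lra.
have ks : 3 - 2 * sigma - 2 * sigmab < kappa by rewrite /kappa; lra.
have kp : kappa + 1 - 2 * p^-1 < 0 by rewrite /kappa; lra.
clearbody kappa.
(* [q < alpha] gives the moment, [1 < q < 2] the truncation estimates, and [q > p] the decay
   [2^(1 - q/p) < 1]. *)
pose q := (Num.max p 1 + Num.min alpha 2) / 2.
have q_ : Num.max p 1 < Num.min alpha 2.
  by rewrite gt_max !lt_min p_alpha p2 alpha1 ltr1n.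
have m4 : p <= Num.max p 1 by rewrite le_max lexx.
have m5 : 1 <= Num.max p 1 by rewrite le_max lexx orbT.
have m6 : Num.min alpha 2 <= alpha by rewrite ge_min lexx.
have m7 : Num.min alpha 2 <= 2 by rewrite ge_min lexx orbT.
have q1 : 1 < q by rewrite /q; lra.
have q2 : q < 2 by rewrite /q; lra.
have qp : p < q by rewrite /q; lra.
have qa : q < alpha by rewrite /q; lra.
clearbody q.
have qpV : 1 - q * p^-1 < 0.
  by rewrite subr_lt0 -(ltr_pM2r p0) mul1r mulfVK ?(gt_eqF p0).
have q0 : 0 < q by apply: lt_trans q1.
have mXY : measurable_fun setT (fun w => X 1 w * Y 1 w) by exact: measurable_funM.
have Iq := L1_powR_of_tail mXY tail q0 qa.
set mu := Ex (fun w => `|X 1 w * Y 1 w| `^ q).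
have mu0 : 0 <= mu by apply: Ex_ge0 => w; exact: powR_ge0.
set s2 := Ex (fun w => X 1 w ^+ 2); set sb2 := Ex (fun w => Y 1 w ^+ 2).
have EX2s l : Ex (fun w => X l w ^+ 2) = s2 := EX2 l.
have EY2s l : Ex (fun w => Y l w ^+ 2) = sb2 := EY2 l.
have s20 : 0 <= s2 := s2_ge0 EX2s.
have sb20 : 0 <= sb2 := s2_ge0 EY2s.
have [K K0 hK] := block_coef_bound sigma12 sigmab12 k0 ks C0 Cb0 cC cbC.
have [A A0 aA] := abs_summable_mul s0 sb0 C0 Cb0 cC cbC.
pose h : R := 2 `^ p^-1.
have h0 : 0 < h by exact: powR_gt0.
(* With this level, [M^(2-q) 2^r] relative to [M^2] and [M^(1-q) 2^r] relative to [M] are both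
   [2^(r (1 - q/p))], which is [rho2^r]. *)
pose M r : R := h ^+ r.
have M0 r : 0 < M r by exact: exprn_gt0.
pose lt_ : rel int := fun l m => l < m; pose gt_ : rel int := fun l m => m < l.
pose U (r N n : nat) w := \sum_(0 <= k < n)
  (offdiag X Y c cb lt_ N k w + offdiag X Y c cb gt_ N k w + diag_part P X Y c cb (M r) N k w).
(* Centring by the window sum of [a], and not yet by [zseries a], makes [S - U] exactly the diagonal
   truncation error; the two centrings agree in the limit [N -> oo]. *)
pose S (N n : nat) w := \sum_(0 <= k < n)
  (\sum_(l <- zrange N) \sum_(m <- zrange N) c (k.+1%:Z - l) * cb (k.+1%:Z - m) * X l w * Y m w
   - e1 * \sum_(l <- zrange N) a (k.+1%:Z - l)).
pose B (r N : nat) w := diag_tail P X Y c cb (M r) N (2 ^ r) w.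
(* One term for each off-diagonal half and one for the truncated diagonal; the 3 comes from
   [sqr_sum3_le]. *)
pose kk r := 3 * (s2 * sb2 * (K * (2 `^ kappa) ^+ r) + s2 * sb2 * (K * (2 `^ kappa) ^+ r) +
  M r `^ (2 - q) * mu * A ^+ 2).
pose bb r := A * (2 ^ r)%:R * (2 * (M r `^ (1 - q) * mu)).
have /andP[r10 r11] := powR2_lt1 kp.
have /andP[r20 r21] := powR2_lt1 qpV.
set rho1 := 2 `^ (kappa + 1 - 2 * p^-1) in r10 r11.
set rho2 := 2 `^ (1 - q * p^-1) in r20 r21.
(* The slower of the off-diagonal and diagonal rates. *)
pose rho := Num.max rho1 rho2.
have rho01 : 0 < rho < 1 by rewrite lt_max r10 gt_max r11.
have rho1r r : rho1 ^+ r <= rho ^+ r.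
  by apply: lerXn2r; rewrite ?nnegrE ?le_max ?lexx ?(ltW r10)//.
have rho2r r : rho2 ^+ r <= rho ^+ r.
  by apply: lerXn2r; rewrite ?nnegrE ?le_max ?lexx ?(ltW r20) ?orbT//.
have MrE (z : R) r : M r `^ z = (2 `^ (p^-1 * z)) ^+ r.
  rewrite /M /h -powR_mulrn ?powR_ge0// -powRrM -powRrM.
  by rewrite -[in RHS]powR_mulrn ?powR_ge0// -powRrM; congr (_ `^ _); ring.
have rho1E r : (2 `^ kappa) ^+ r * 2 ^+ r = rho1 ^+ r * (h ^+ r) ^+ 2.
  have -> : (h ^+ r) ^+ 2 = (2 `^ (2 * p^-1)) ^+ r.
    by rewrite exprAC; congr (_ ^+ _); rewrite -powR_mulrn ?powR_ge0// -powRrM mulrC.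
  rewrite /rho1 -powR2_expr_split subrK powR2_expr_split powRr1//.
have rho2E r : M r `^ (2 - q) * 2 ^+ r = rho2 ^+ r * (h ^+ r) ^+ 2.
  have -> : (h ^+ r) ^+ 2 = (2 `^ (2 * p^-1)) ^+ r.
    by rewrite exprAC; congr (_ ^+ _); rewrite -powR_mulrn ?powR_ge0// -powRrM mulrC.
  rewrite MrE /rho2 -powR2_expr_split -[in X in _ * X ^+ _](powRr1 (ler0n R 2)).
  by rewrite -powR2_expr_split; congr (_ `^ _ ^+ _); ring.
have rho3E r : M r `^ (1 - q) * 2 ^+ r = rho2 ^+ r * h ^+ r.
  rewrite MrE /rho2 /h -powR2_expr_split -[in X in _ * X ^+ _](powRr1 (ler0n R 2)).
  by rewrite -powR2_expr_split; congr (_ `^ _ ^+ _); ring.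
pose KK := 3 * (2 * (s2 * sb2 * K) + mu * A ^+ 2) + 2 * A * mu.
apply: (@ae_marcinkiewicz _ _ _ P U B S _ kk bb p KK rho) => //.
- by rewrite addr_ge0 ?mulr_ge0 ?addr_ge0 ?mulr_ge0 ?sqr_ge0.
- by move=> r; rewrite /kk !(mulr_ge0, addr_ge0) ?sqr_ge0 ?exprn_ge0 ?powR_ge0.
- by move=> r N w; rewrite /U big_geq.
- move=> r N x y xy yr.
  have lt_irr l m : lt_ l m -> l != m by move=> /lt_eqF ->.
  have lt_asym l m : lt_ l m -> ~~ lt_ m l by rewrite /lt_ -leNgt => /ltW.
  have gt_irr l m : gt_ l m -> l != m by move=> /gt_eqF ->.
  have gt_asym l m : gt_ l m -> ~~ gt_ m l by rewrite /gt_ -leNgt => /ltW.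
  have hKN := hK r x y (zrange N) (uniq_zrange N) xy yr.
  have [I1 E1] := offdiag_block mX mY indV EX0 EY0 IX2 IY2 EX2s EY2s lt_irr lt_asym hKN.
  have [I2 E2] := offdiag_block mX mY indV EX0 EY0 IX2 IY2 EX2s EY2s gt_irr gt_asym hKN.
  have [I3 E3] := diag_part_block mX mY indV idV A0 aA q1 q2 Iq (erefl mu) N (M0 r) xy.
  have UE w : (U r N y w - U r N x w) ^+ 2 <= 3 * (
      (\sum_(x <= k < y) offdiag X Y c cb lt_ N k w) ^+ 2 +
      (\sum_(x <= k < y) offdiag X Y c cb gt_ N k w) ^+ 2 +
      (\sum_(x <= k < y) diag_part P X Y c cb (M r) N k w) ^+ 2).
    by rewrite /U sumr_natB// !big_split/=; exact: sqr_sum3_le.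
  have I123 := L1Z 3 (L1D (L1D I1 I2) I3).
  have mU z : measurable_fun setT (U r N z).
    apply: measurable_sum => k; apply: measurable_funD; first apply: measurable_funD.
    + apply: measurable_sum => l; apply: measurable_sum => m.
      apply: measurable_funM => //; rewrite /prodXY/=.
      by case: (lt_ l m); [exact: measurable_funM|exact: measurable_cst].
    + apply: measurable_sum => l; apply: measurable_sum => m.
      apply: measurable_funM => //; rewrite /prodXY/=.
      by case: (gt_ l m); [exact: measurable_funM|exact: measurable_cst].
    + apply: measurable_sum => l; apply: measurable_funM => //; apply: measurable_funB => //.
      by apply: (measurableT_comp (measurable_trunc _)); exact: measurable_funM.
  have IU : L1 (fun w => (U r N y w - U r N x w) ^+ 2).
    apply: L1_le I123; first by apply: measurable_funX; exact: measurable_funB.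
    by move=> w; rewrite ger0_norm ?sqr_ge0.
  split=> //; apply: (le_trans (Ex_le IU I123 UE)).
  rewrite ExZ; last by exact: L1D (L1D I1 I2) I3.
  rewrite (ExD (L1D I1 I2) I3) (ExD I1 I2) /kk -mulrA ler_pM2l//.
  apply: (le_trans (lerD (lerD E1 E2) E3)).
  by rewrite le_eqVlt; apply/orP; left; apply/eqP; ring.
- by move=> r N w; exact: diag_tail_ge0.
- by move=> r N; have [] := Ex_diag_tail mX mY idV IX2 IY2 A0 aA q1 q2 Iq (erefl mu) N (2 ^ r) (M0 r).
- by move=> r N; have [] := Ex_diag_tail mX mY idV IX2 IY2 A0 aA q1 q2 Iq (erefl mu) N (2 ^ r) (M0 r).
- move=> r N n w nr.
  have hb := @diag_tail_bound _ _ _ P X Y mX mY idV IX2 IY2 c cb q mu q1 q2 Iq erefl (M r) N r n w (M0 r) nr.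
  apply: le_trans hb.
  rewrite /S /U -sumrB le_eqVlt; apply/orP; left; apply/eqP.
  congr (`|_|); apply: eq_bigr => k _.
  rewrite offdiag_split; rewrite /lt_ /gt_ /e1; ring.
- move=> r; rewrite -/h.
  have -> : kk r * 2 ^+ r = 3 * (2 * (s2 * sb2 * K) * ((2 `^ kappa) ^+ r * 2 ^+ r) +
     mu * A ^+ 2 * (M r `^ (2 - q) * 2 ^+ r)).
    by rewrite /kk; set u := 2 ^+ r; ring.
  rewrite rho1E rho2E.
  have H0 : 0 <= (h ^+ r) ^+ 2 by exact: sqr_ge0.
  have c1 : 0 <= s2 * sb2 * K by rewrite !mulr_ge0.
  have c2 : 0 <= mu * A ^+ 2 by rewrite mulr_ge0 ?sqr_ge0.
  have c3 : 0 <= 2 * A * mu by rewrite !mulr_ge0.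
  have y1 := ler_wpM2l c1 (ler_wpM2r H0 (rho1r r)).
  have y2 := ler_wpM2l c2 (ler_wpM2r H0 (rho2r r)).
  have y3 : 0 <= 2 * A * mu * (rho ^+ r * (h ^+ r) ^+ 2).
    by rewrite mulr_ge0// mulr_ge0// exprn_ge0// ltW//; case/andP: rho01.
  rewrite /KK -[leRHS]mulrA.
  move: y1 y2 y3; set W := rho ^+ r * _; set W1 := rho1 ^+ r * _; set W2 := rho2 ^+ r * _.
  set u := s2 * sb2 * K; set v := mu * A ^+ 2; set z := 2 * A * mu.
  move: W W1 W2 u v z => W W1 W2 u v z; rewrite !mulrDl; lra.
- move=> r; rewrite -/h /bb natrX.
  have c3 : 0 <= 2 * A * mu by rewrite !mulr_ge0.
  have -> : A * 2 ^+ r * (2 * (M r `^ (1 - q) * mu)) = 2 * A * mu * (M r `^ (1 - q) * 2 ^+ r).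
    by set u := 2 ^+ r; ring.
  rewrite rho3E -[leRHS]mulrA.
  have hr : rho2 ^+ r * h ^+ r <= rho ^+ r * h ^+ r by rewrite ler_wpM2r// ltW.
  apply: (le_trans (ler_wpM2l c3 hr)); rewrite ler_wpM2r//.
    by rewrite mulr_ge0 ?exprn_ge0 ?(ltW h0)//; case/andP: rho01 => /ltW.
  by rewrite /KK lerDr !(mulr_ge0, addr_ge0) ?sqr_ge0.
(* For fixed [n] only finitely many times are involved, so the limit in [N] is taken term by
   term. *)
- apply: filterS ae_cvg_dk => w hw n.
  elim: n => [|n ih].
    rewrite big_geq// (_ : (fun N => S N 0%N w) = fun=> 0); first exact: cvg_cst.
    by apply/funext => N; rewrite /S big_geq.
  rewrite big_nat_recr//= (_ : (fun N => S N n.+1 w) = (fun N => S N n w +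
    (\sum_(l <- zrange N) \sum_(m <- zrange N)
       c (n.+1%:Z - l) * cb (n.+1%:Z - m) * X l w * Y m w -
     e1 * \sum_(l <- zrange N) a (n.+1%:Z - l)))); last first.
    by apply/funext => N; rewrite /S big_nat_recr.
  apply: cvgD => //; apply: cvgB; first exact: hw.
  by apply: cvgM; [exact: cvg_cst|exact: (abs_summable_cvg A0 aA)].
Qed.

End strong_law.

Unset Implicit Arguments.
Set Strict Implicit.

(** The bound on [p] by the minimum is split into three inequalities, the first multiplied out so
    that [sigma = sigmab = 1], where [1/(2 - sigma - sigmab)] is infinite, imposes nothing. *)
Theorem theorem3 (d : measure_display) (T : measurableType d) (R : realType)
  (P : probability T R) (xi xib : int -> {RV P >-> R})
  (c cb : int -> R) (alpha sigma sigmab p : R) :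
  mutually_independent P (rvpair (fun l => xi l : T -> R) (fun l => xib l : T -> R)) ->
  identically_distributed P (rvpair (fun l => xi l : T -> R) (fun l => xib l : T -> R)) ->
  (forall l, ('E_P[xi l] = 0)%E) ->
  (forall l, ('E_P[xib l] = 0)%E) ->
  (\int[P]_w ((xi 1 w) ^+ 2)%:E < +oo)%E ->
  (\int[P]_w ((xib 1 w) ^+ 2)%:E < +oo)%E ->
  1 < alpha ->
  (exists C : R, forall t : R, 0 <= t ->
     ((t `^ alpha)%:E * P [set w | (t < `|xi 1 w * xib 1 w|)%R] <= C%:E)%E) ->
  1 / 2 < sigma <= 1 -> 1 / 2 < sigmab <= 1 ->
  (exists C : R, forall l : int, `|(l%:~R : R)| `^ sigma * `|c l| <= C) ->
  (exists C : R, forall l : int, `|(l%:~R : R)| `^ sigmab * `|cb l| <= C) ->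
  0 < p ->
  p * (2 - sigma - sigmab) < 1 -> p < alpha -> p < 2 ->
  let dd := fine (\int[P]_w (xi 1 w * xib 1 w)%:E)%E * zseries (fun l => c l * cb l) in
  {ae P, forall w, (fun n : nat =>
      (\sum_(1 <= k < n.+1)
         (dk c cb (fun l => xi l : T -> R) (fun l => xib l : T -> R) k%:Z w - dd))
      / (n%:R `^ p^-1)) @ \oo --> (0 : R)}.
Proof.
move=> indV idV EX EY IX IY alpha1 tail sigma12 sigmab12 hc hcb p0 psigma palpha p2 dd.
have mX l : measurable_fun setT (xi l : T -> R) by exact: measurable_funPT.
have mY l : measurable_fun setT (xib l : T -> R) by exact: measurable_funPT.
have EX0 l : Ex P (xi l) = 0 by rewrite /Ex /Rintegral -expectation_def EX.
have EY0 l : Ex P (xib l) = 0 by rewrite /Ex /Rintegral -expectation_def EY.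
have IX1 : L1 P (fun w => xi 1 w ^+ 2).
  by apply: L1_ge0 => // [|w]; [exact: measurable_funX|exact: sqr_ge0].
have IY1 : L1 P (fun w => xib 1 w ^+ 2).
  by apply: L1_ge0 => // [|w]; [exact: measurable_funX|exact: sqr_ge0].
have s0 : 0 < sigma by have /andP[+ _] := sigma12; lra.
have sb0 : 0 < sigmab by have /andP[+ _] := sigmab12; lra.
have [C C0 cC] := coef_wgt_bound s0 hc.
have [Cb Cb0 cbC] := coef_wgt_bound sb0 hcb.
have := ae_strong_law mX mY indV idV EX0 EY0 IX1 IY1 tail sigma12 sigmab12 C0 Cb0 cC cbC
  alpha1 p0 psigma palpha p2.
apply: filterS => w hw.
(* Times 1 to [n] are reindexed as [k+1] with [0 <= k < n]. *)
rewrite (_ : (fun n : nat => _) = (fun n => (\sum_(0 <= k < n)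
  (dk c cb (fun l => xi l : T -> R) (fun l => xib l : T -> R) k.+1%:Z w - dd)) / n%:R `^ p^-1)).
  exact: hw.
by apply/funext => n; rewrite big_add1.
Qed.
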